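(* Let $f\in\mathcal A_c(\mathbb R^2)$ and $g\in L^1(\mathbb R^2)$. Define $f\ast g$ as the unique distribution in $\mathcal A_c(\mathbb R^2)$ such that $\lim_{n\to\infty}\lVert f_n\ast g-f\ast g\rVert=0$, where $\{f_n\}\subset L^1(\mathbb R^2)$ is any sequence with $\lim_{n\to\infty}\lVert f_n-f\rVert=0$. Then: (a) $f\ast g\in\mathcal A_c(\mathbb R^2)$ and $\lVert f\ast g\rVert\le\lVert f\rVert\,\lVert g\rVert_1$. (b) Let $h\in L^1(\mathbb R^2)$. Then $(f\ast g)\ast h=f\ast(g\ast h)\in\mathcal A_c(\mathbb R^2)$. (c) Define $g_r(x,y)=r^{-2}g(r^{-1}x,r^{-1}y)$ for $r>0$. Let $A=\int_{-\infty}^\infty\int_{-\infty}^\infty g_r(x,y)\,dy\,dx=\int_{-\infty}^\infty\int_{-\infty}^\infty g$. Then $\lVert f\ast g_r-Af\rVert\to0$ as $r\to0^+$.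
   Context: $\overline{\mathbb R}=[-\infty,\infty]$ is the two-point compactification of $\mathbb R$, and $\overline{\mathbb R}^2$ carries the product topology. $\mathcal B_c(\overline{\mathbb R}^2)$ is the set of continuous $F:\overline{\mathbb R}^2\to\mathbb R$ with $F(-\infty,s)=F(s,-\infty)=0$ for all $s\in\overline{\mathbb R}$. $\partial_{12}=\partial_1\partial_2$ is the distributional derivative on $\mathbb R^2$, and $\mathcal A_c(\mathbb R^2)=\{\partial_{12}F\mid F\in\mathcal B_c(\overline{\mathbb R}^2)\}\subset\mathcal D'(\mathbb R^2)$; the primitive $F\in\mathcal B_c(\overline{\mathbb R}^2)$ of $f=\partial_{12}F$ is unique and the Alexiewicz norm is $\lVert f\rVert=\lVert F\rVert_\infty$. Each $f\in L^1(\mathbb R^2)$ is identified with the distribution it defines, which lies in $\mathcal A_c(\mathbb R^2)$ with primitive $\int_{-\infty}^x\int_{-\infty}^yf$; $L^1(\mathbb R^2)$ is dense in $\mathcal A_c(\mathbb R^2)$. For $f_n,g\in L^1(\mathbb R^2)$, $f_n\ast g(x,y)=\int_{-\infty}^\infty\int_{-\infty}^\infty f_n(x-s,y-t)g(s,t)\,dt\,ds$ is the usual convolution. The limit defining $f\ast g$ exists and is independent of the sequence $\{f_n\}$. $\lVert\cdot\rVert_1$ is the $L^1(\mathbb R^2)$ norm. *)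

(* Defs.v *)
From HB Require Import structures.
From mathcomp Require Import all_boot all_order all_algebra.
From mathcomp Require Import all_classical all_reals all_analysis.

Set Implicit Arguments.
Unset Strict Implicit.
Unset Printing Implicit Defensive.

Import Order.TTheory GRing.Theory Num.Theory.
Import numFieldNormedType.Exports.

Local Open Scope classical_set_scope.
Local Open Scope ring_scope.

Section TestFunctions.
Context {R : realType}.
Implicit Types (phi : R * R -> R) (w : seq bool) (b : bool).

(* A boolean selects a coordinate: [false] the first one, [true] the second. *)
Definition axis b : R * R := if b then (0, 1) else (1, 0).

Definition pd b phi : R * R -> R := fun z => 'D_(axis b) phi z.

(* [pds [:: b1; b2; ...] phi] is d_b1 (d_b2 (... phi)). *)
Definition pds w phi : R * R -> R := foldr pd phi w.

Definition smooth phi :=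
  forall w, continuous (pds w phi) /\
    forall b z, derivable (pds w phi) z (axis b).

Definition tsupport phi : set (R * R) := closure [set z | phi z != 0].

Definition test_fun : {pred R * R -> R} :=
  fun phi => `[< smooth phi /\ compact (tsupport phi) >].

Lemma pdsD w phi psi : smooth phi -> smooth psi ->
  pds w (phi + psi) = pds w phi + pds w psi.
Proof.
move=> sphi spsi; elim: w => //= b w ->; apply/funext => z.
by rewrite /pd deriveD//; [case: (sphi w)|case: (spsi w)].
Qed.

Lemma pdsZ w (a : R) phi : smooth phi -> pds w (a *: phi) = a *: pds w phi.
Proof.
move=> sphi; elim: w => //= b w ->; apply/funext => z.
by rewrite /pd deriveZ//; case: (sphi w).
Qed.

Lemma pds0 w : pds w 0 = 0.
Proof.
by elim: w => //= b w ->; apply/funext => z; rewrite /pd (derive_cst (0 : R)).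
Qed.

Lemma smooth0 : smooth 0.
Proof.
by move=> w; rewrite pds0; split => [z|b z]; [exact: cst_continuous|exact: derivable_cst].
Qed.

Lemma support_subset_compact phi (K : set (R * R)) :
  compact K -> closed K -> (forall z, ~ K z -> phi z = 0) ->
  compact (tsupport phi).
Proof.
move=> cK clK phiK; apply: (subclosed_compact _ cK); first exact: closed_closure.
rewrite /tsupport (closure_id K).1//; apply: closure_subset => z /= /eqP phiz.
by apply: contrapT => /phiK.
Qed.

Lemma notin_support phi z : ~ tsupport phi z -> phi z = 0.
Proof.
move=> nz; apply: contrapT => /eqP phiz; apply: nz; exact: subset_closure.
Qed.

Lemma test_fun_submod : submod_closed test_fun.
Proof.
split=> [|a phi psi].
  rewrite unfold_in; apply/asboolP; split; first exact: smooth0.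
  by apply: (support_subset_compact compact0); [exact: closed0|].
rewrite !unfold_in => /asboolP[sphi cphi] /asboolP[spsi cpsi].
have saphi : smooth (a *: phi).
  move=> w; rewrite pdsZ//; have [cw dw] := sphi w; split=> [z|b z].
    by apply: continuousM; [exact: cst_continuous|exact: cw].
  exact: derivableZ.
apply/asboolP; split.
  move=> w; rewrite pdsD//; have [c1 d1] := saphi w; have [c2 d2] := spsi w.
  by split=> [z|b z]; [apply: continuousD; [exact: c1|exact: c2]|exact: derivableD].
apply: (@support_subset_compact _ (tsupport phi `|` tsupport psi)).
- exact: compactU.
- by apply: closedU; exact: closed_closure.
- move=> z /not_orP[/notin_support p0 /notin_support q0].
  by rewrite -[LHS]/(a * phi z + psi z) p0 q0 mulr0 addr0.
Qed.

Lemma pds_cat w1 w2 phi : pds w1 (pds w2 phi) = pds (w1 ++ w2) phi.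
Proof. by rewrite /pds foldr_cat. Qed.

Lemma test_fun_pd b phi : phi \in test_fun -> pd b phi \in test_fun.
Proof.
rewrite !unfold_in => /asboolP[sphi cphi]; apply/asboolP; split.
  by move=> w; rewrite -[pd b phi]/(pds [:: b] phi) pds_cat; exact: sphi.
apply: (support_subset_compact cphi); first exact: closed_closure.
move=> z nz; rewrite /pd.
have near0 : \near z, phi z = cst 0 z.
  have : nbhs z (~` tsupport phi).
    by apply: open_nbhs_nbhs; split => //; exact/closed_openC/closed_closure.
  by apply: filterS => y /notin_support ->.
by rewrite (near_eq_derive _ near0) (derive_cst (0 : R)).
Qed.

HB.instance Definition _ :=
  GRing.isSubmodClosed.Build R (R * R -> R) test_fun test_fun_submod.

End TestFunctions.

(* The space D(R^2) of compactly supported smooth functions. *)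
Definition testFun (R : realType) := {phi : R * R -> R | phi \in test_fun}.
HB.instance Definition _ (R : realType) := SubType.on (testFun R).
HB.instance Definition _ (R : realType) := SubChoice.on (testFun R).
HB.instance Definition _ (R : realType) :=
  [SubChoice_isSubLmodule of testFun R by <:].

Section Distributions.
Context {R : realType}.
Implicit Types (phi : testFun R) (T : testFun R -> R) (b : bool).

Definition tpd b phi : testFun R :=
  exist (fun psi => psi \in test_fun) _ (test_fun_pd b (valP phi)).

(* Sequential convergence in D(R^2). *)
Definition cvg_testFun (u : nat -> testFun R) phi :=
  (exists2 K : set (R * R), compact K &
    forall n, tsupport (val (u n)) `<=` K) /\
  forall w : seq bool,
    {uniform, (fun n => pds w (val (u n))) @ \oo --> pds w (val phi)}.

(* D'(R^2); on the LF-space D(R^2) a linear functional is continuous if and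
   only if it is sequentially continuous. *)
Definition distributions : set (testFun R -> R) := [set T |
  scalar T /\
  forall u phi, cvg_testFun u phi -> T (u n) @[n --> \oo] --> T phi].

Definition dpd b T : testFun R -> R := fun phi => - T (tpd b phi).

Definition d12 T : testFun R -> R := dpd false (dpd true T).

Definition leb2 := (@lebesgue_measure R \x @lebesgue_measure R)%E.

(* The distribution defined by a locally integrable function. *)
Definition regular_distr (F : R * R -> R) : testFun R -> R :=
  fun phi => (\int[leb2]_z (F z * val phi z))%R.

End Distributions.

Section Alexiewicz.
Context {R : realType}.
Implicit Types (f u : testFun R -> R) (g h : R * R -> R).

Definition Bc : set (\bar R * \bar R -> R) := [set F |
  continuous F /\ forall s, F (-oo%E, s) = 0 /\ F (s, -oo%E) = 0].

Definition restrict2 (F : \bar R * \bar R -> R) : R * R -> R :=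
  fun z => F (z.1%:E, z.2%:E).

(* The conjunct [distributions f] is redundant; it records Ac `<=` D'. *)
Definition Ac : set (testFun R -> R) := [set f | distributions f /\
  exists2 F, Bc F & f = d12 (regular_distr (restrict2 F))].

(* Only meaningful on [Ac], where the primitive exists and is unique. *)
Definition primitive f : \bar R * \bar R -> R :=
  get [set F | Bc F /\ f = d12 (regular_distr (restrict2 F))].

Definition anorm f : R := sup [set `|primitive f z| | z in setT].

(* [leb2] lives on the Borel sets; every L^1 class has a Borel representative. *)
Definition L1 : set (R * R -> R) :=
  [set g | leb2.-integrable setT (EFin \o g)].

Definition normL1 g : R := fine 'N[leb2]_1[EFin \o g]%E.

(* Iterated Lebesgue integral, the second variable being integrated first. *)
Definition iint g : R :=
  fine (\int[lebesgue_measure]_s \int[lebesgue_measure]_t (g (s, t))%:E)%E.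

(* Usual convolution of integrable functions; its value is arbitrary on the
   null set where the integral does not exist. *)
Definition convL1 g h : R * R -> R :=
  fun z => iint (fun w => g (z.1 - w.1, z.2 - w.2) * h w).

(* By density of L1 in [Ac], such sequences [fn] exist and [u] is unique. *)
Definition is_conv f g u := Ac u /\
  forall fn : nat -> R * R -> R, (forall n, L1 (fn n)) ->
    anorm (regular_distr (fn n) - f) @[n --> \oo] --> (0 : R) ->
    anorm (regular_distr (convL1 (fn n) g) - u) @[n --> \oo] --> (0 : R).

Definition convAc f g : testFun R -> R := get (is_conv f g).

Definition dilate (r : R) g : R * R -> R :=
  fun z => r ^- 2 * g (r^-1 * z.1, r^-1 * z.2).

End Alexiewicz.

(* Main.v *)
From HB Require Import structures.
Require Import Defs.
From mathcomp Require Import all_boot all_order all_algebra.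
From mathcomp Require Import all_classical all_reals all_analysis.
From mathcomp Require Import lra measurable_realfun.
Import Order.TTheory GRing.Theory Num.Theory.
Import numFieldNormedType.Exports.
Local Open Scope classical_set_scope.
Local Open Scope ring_scope.

Set Implicit Arguments.
Unset Strict Implicit.
Unset Printing Implicit Defensive.

(**
  Everything is read off the primitives. For a bounded function [Phi] of the
  extended plane, let [smear Phi g] be the function sending [z] to the integral
  of [Phi (z - w) g(w) dw]. Translations by real vectors extend continuously
  to infinity, so for a primitive [F] dominated convergence makes [smear F g]
  a primitive again ([smear_Bc]), of sup norm at most that of [F] times the
  L1 norm of [g]. For the indicator [quadrant] of the closed first quadrant,
  [smear quadrant g] is the primitive of [g] itself ([d12_smear_quadrant]).

  Fubini and translation invariance give the associativity
  [smear (smear Phi g) h = smear Phi (convL1 g h)] ([smear_smear]) for every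
  bounded [Phi], continuous or not. With [Phi = quadrant] it says that if [F_n]
  is the primitive of [f_n], then that of the convolution of [f_n] and [g] is
  [smear F_n g]. Hence the convolutions of [f_n] and [g] converge to the mixed
  derivative of [smear F g] as soon as [F_n] tends to [F] uniformly: this
  mixed derivative is the convolution of [f] and [g] ([convAc_mixed]), and (a)
  is the bound on the sup norm. With [Phi = F], the associativity is (b).

  For (c), the primitive at stake is, at [z], the integral of
  [(F (z - r w) - F z) g(w) dw]. Since [F] is uniformly continuous, it tends to
  0 along any choice of points [z] depending on [r], by dominated convergence,
  and therefore uniformly ([cvg_concentrate], [cvg_dilate]).

  Two facts about the space of primitives support this. A primitive is
  determined by its mixed derivative ([primitive_unique0]): tested against a
  product of differences of smooth steps, the mixed derivative yields averages
  of the increments of [F] over rectangles; the steps are sharpened, then two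
  sides of the rectangle are sent to minus infinity. The primitives of L1
  functions are dense ([smear_quadrant_dense]): on the compact extended plane,
  [F] is interpolated by a partition of unity made of differences of
  distribution functions of uniform densities.
*)

(** * Lebesgue measure of the plane *)

Section leb2_sigma_finite.
Context {R : realType}.
Local Notation mR2 := (measurableTypeR R * measurableTypeR R)%type.
Local Notation mu := (@lebesgue_measure R).

(** Sigma-finiteness is what lets Fubini exchange two integrals over the
    plane, as the associativity of convolution requires. *)
HB.instance Definition _ := Measure.copy (@leb2 R) (mu \x mu)%E.

Let sigma_finite_leb2 : sigma_finite [set: mR2] (@leb2 R).
Proof.
have /sigma_finiteP[F [TF ndF Foo]] := sigma_finiteT mu.
exists (fun n => F n `*` F n).
  rewrite -setXTT TF predeqE => -[x y]; split.
    move=> [/= [n _ Fnx] [k _ Fky]]; exists (maxn n k) => //; split.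
    - by move: x Fnx; exact/subsetPset/ndF/leq_maxl.
    - by move: y Fky; exact/subsetPset/ndF/leq_maxr.
  by move=> [n _ []/= ? ?]; split; exists n.
move=> k; have [mFk Fk] := Foo k; split; first exact: measurableX.
by rewrite /leb2 product_measure1E// lte_mul_pinfty// ge0_fin_numE.
Qed.

HB.instance Definition _ := Measure_isSigmaFinite.Build _ _ _ (@leb2 R)
  sigma_finite_leb2.

#[global] Instance ae_leb2_filter : Filter (almost_everywhere (@leb2 R)).
Proof. exact: ae_filter_ringOfSetsType. Qed.

End leb2_sigma_finite.

(** * Affine changes of variables *)

Section change_of_variables.
Context {R : realType}.
Local Notation mR := (measurableTypeR R).
Local Notation mR2 := (measurableTypeR R * measurableTypeR R)%type.
Local Notation mu := (@lebesgue_measure R).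
Local Notation leb2 := (@leb2 R).

Lemma measurable_affine (a b : R) :
  @measurable_fun _ _ mR mR setT (fun x : mR => a * x + b).
Proof. by apply: measurable_funD => //; exact: measurable_funM. Qed.

(** By uniqueness of Lebesgue measure, it suffices to compare intervals. *)
Lemma lebesgue_measure_affine (a b : R) (A : set mR) :
  0 < a -> measurable A ->
  (mu A = a%:E * mu ((fun x : R => a * x + b)%R @^-1` A))%E.
Proof.
move=> a0 mA.
pose phi (x : mR) : mR := a * x + b.
suff : forall X, measurable X ->
    mu X = mscale (NngNum (ltW a0)) (pushforward mu phi) X by move=> H; rewrite (H (measurable_affine a b) A mA).
move=> mphi; apply: lebesgue_measure_unique.
move=> _ [[c d] /= _ <-].
rewrite /mscale /=.
rewrite -[pushforward _ _ _]/(mu (phi @^-1` `]c, d]%classic)).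
have -> : phi @^-1` `]c, d] =
    `](c - b) / a, (d - b) / a]%classic.
  apply/seteqP; split => x /=; rewrite !in_itv/= ltr_pdivrMr// ler_pdivlMr//;
    by rewrite ltrBlDr lerBrDr mulrC.
rewrite !lebesgue_measure_itv/= !lte_fin ltr_pM2r ?invr_gt0// ltrD2r.
case: ifPn => [cd|_]; last by rewrite mule0.
rewrite -!EFinD -EFinM; congr EFin.
by rewrite -mulrBl mulrCA mulfV ?gt_eqF//; lra.
Qed.

Lemma ge0_integral_affine (a b : R) (f : R -> \bar R) : 0 < a ->
  measurable_fun [set: mR] f -> (forall x, 0 <= f x)%E ->
  (\int[mu]_x f (a * x + b)%R = (a^-1)%:E * \int[mu]_x f x)%E.
Proof.
move=> a0 mf f0; have mphi := measurable_affine a b.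
have := ge0_integral_pushforward mphi mu measurableT mf (fun y _ => f0 y).
rewrite preimage_setT => <-.
have ai0 : 0 <= a^-1 by rewrite invr_ge0 ltW.
have := ge0_integral_mscale mu measurableT (NngNum ai0) mf (fun x _ => f0 x).
move=> /= <-; apply: eq_measure_integral => A mA _.
transitivity ((a^-1)%:E * mu A)%E; last by [].
rewrite (lebesgue_measure_affine b a0 mA) muleA -EFinM.
by rewrite mulVf ?gt_eqF// mul1e.
Qed.

Definition affine2 (a : R) (b : R * R) (z : mR2) : mR2 :=
  (a * z.1 + b.1, a * z.2 + b.2).

Lemma measurable_affine2 a b : measurable_fun setT (affine2 a b).
Proof.
apply: measurable_fun_pair.
  by apply: (measurableT_comp (measurable_affine a b.1)).
by apply: (measurableT_comp (measurable_affine a b.2)).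
Qed.

Lemma ge0_integral_affine2 a b (f : R * R -> \bar R) : 0 < a ->
  measurable_fun [set: mR2] f -> (forall x, 0 <= f x)%E ->
  (\int[leb2]_z f (affine2 a b z) = (a^-2)%:E * \int[leb2]_z f z)%E.
Proof.
move=> a0 mf f0.
have mfa : measurable_fun [set: mR2] (f \o affine2 a b).
  by apply: measurableT_comp => //; exact: measurable_affine2.
have mF := @measurable_fun_fubini_tonelli_F _ _ mR mR R mu f mf f0.
rewrite /Defs.leb2 (@fubini_tonelli1 _ _ mR mR _ mu mu (f \o affine2 a b))//.
rewrite (@fubini_tonelli1 _ _ mR mR _ mu mu f)//=.
pose F (x : mR) := (\int[mu]_y f (x, y))%E.
rewrite (eq_integral (fun x : mR => (a^-1)%:E * F (a * x + b.1)%R)%E); last first.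
  move=> x _; apply: (@ge0_integral_affine a b.2 (fun y => f (a * x + b.1, y))) => //.
  by apply: measurableT_comp => //; exact: measurable_pair1.
rewrite ge0_integralZl//; last 3 first.
- apply: (measurableT_comp (f := F)) => //; exact: measurable_affine.
- by move=> x _; exact: integral_ge0.
- by rewrite lee_fin invr_ge0 ltW.
rewrite (@ge0_integral_affine a b.1 F) //.
  by rewrite muleA -EFinM -invfM.
  by move=> x; exact: integral_ge0.
by move=> z; exact: f0.
Qed.

End change_of_variables.

(** * Real-valued integrals *)

Section real_integrals.
Context d (T : measurableType d) {R : realType} (mu : {measure set T -> \bar R}).
Implicit Types f g phi : T -> R.

Lemma integrable_bounded_mul phi g (C : R) :
  measurable_fun setT phi -> (forall x, `|phi x| <= C) ->
  mu.-integrable setT (EFin \o g) ->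
  mu.-integrable setT (EFin \o (fun x => phi x * g x)).
Proof.
move=> mphi phiC ig.
have mg : measurable_fun setT g by apply/measurable_EFinP; exact: measurable_int ig.
apply: (@le_integrable _ _ _ _ _ _ _ (fun x => C%:E * (g x)%:E)%E) => //=.
- by apply/measurable_EFinP; exact: measurable_funM.
- move=> x _; rewrite lee_fin !normrM ler_wpM2r//.
  by rewrite (le_trans (phiC x))// ler_norm.
- exact: integrableZl.
Qed.

Lemma normr_Rintegral_le f g : measurable_fun setT f ->
  mu.-integrable setT (EFin \o g) -> (forall x, `|f x| <= g x) ->
  `|\int[mu]_x f x| <= \int[mu]_x g x.
Proof.
move=> mf ig fg.
have if_ : mu.-integrable setT (EFin \o f).
  apply: (le_integrable measurableT _ _ ig); first exact/measurable_EFinP.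
  by move=> x _ /=; rewrite lee_fin (le_trans (fg x))// ler_norm.
apply: (le_trans (le_normr_Rintegral measurableT if_)).
apply: le_Rintegral => //; exact: integrable_norm.
Qed.

Lemma Rintegral_dominated_cvg (fn : nat -> T -> R) f g :
  (forall n, measurable_fun setT (fn n)) -> measurable_fun setT f ->
  mu.-integrable setT (EFin \o g) -> (forall n x, `|fn n x| <= g x) ->
  {ae mu, forall x, fn n x @[n --> \oo] --> f x} ->
  \int[mu]_x fn n x @[n --> \oo] --> \int[mu]_x f x.
Proof.
move=> mfn mf ig fg fnf.
have [||||| if_ _ cv] := @dominated_convergence _ _ _ mu setT measurableT
  (fun n => EFin \o fn n) (EFin \o f) (EFin \o g).
- by move=> n; exact/measurable_EFinP.
- exact/measurable_EFinP.
- apply: filterS fnf => x fnfx _; by apply: cvg_EFin; first exact: nearW.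
- exact: ig.
- by apply: aeW => x n _ /=; rewrite lee_fin.
apply: fine_cvg; rewrite fineK; first exact: cv.
exact: integrable_fin_num if_.
Qed.

(** An integrable function is finite almost everywhere, so that cutting off its
    infinite values changes nothing; partial integrals of real functions can
    then be taken in the reals. *)
Lemma integrable_fine (f : T -> \bar R) : mu.-integrable setT f ->
  mu.-integrable setT (EFin \o (fine \o f)) /\
  (\int[mu]_x (fine (f x))%:E = \int[mu]_x f x)%E.
Proof.
move=> if_.
have mf := measurable_int _ if_.
have mff : measurable_fun setT (EFin \o (fine \o f)).
  by apply/measurable_EFinP; exact: measurableT_comp.
split.
  apply: (le_integrable measurableT mff _ if_) => x _ /=.
  by case: (f x) => [r| |] //=; rewrite ?normr0 ?leey.
apply: ae_eq_integral => //.
apply: filterS (integrable_ae measurableT if_) => x /= + _ => /(_ I) fx.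
by rewrite fineK.
Qed.

End real_integrals.

Section real_fubini.
Context d1 d2 (T1 : measurableType d1) (T2 : measurableType d2) {R : realType}.
Variables (m1 : {sigma_finite_measure set T1 -> \bar R}).
Variables (m2 : {sigma_finite_measure set T2 -> \bar R}).

Lemma Rfubini1 (K : T1 * T2 -> R) : (m1 \x m2)%E.-integrable setT (EFin \o K) ->
  \int[(m1 \x m2)%E]_z K z = \int[m1]_x \int[m2]_y K (x, y).
Proof.
move=> iK; rewrite /Rintegral -(integral12_prod_meas1 iK).
by have [_ ->] := integrable_fine (integrable_fubini_F iK).
Qed.

Lemma Rfubini2 (K : T1 * T2 -> R) : (m1 \x m2)%E.-integrable setT (EFin \o K) ->
  \int[(m1 \x m2)%E]_z K z = \int[m2]_y \int[m1]_x K (x, y).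
Proof.
move=> iK; rewrite /Rintegral -(integral21_prod_meas1 iK).
have mK := measurable_int _ iK.
(* the second partial integral is a first one for the transposed kernel *)
have mKs : measurable_fun setT (fun z => (K (z.2, z.1))%:E).
  by apply: (measurableT_comp mK); exact: measurable_swap.
have iKs : (m2 \x m1)%E.-integrable setT (fun z => (K (z.2, z.1))%:E).
  by apply/(integrable12ltyP _ _ mKs); exact: (integrable21ltyP m1 m2 mK).1 iK.
by have [_ ->] := integrable_fine (integrable_fubini_F iKs).
Qed.

Lemma integrable_tensor (a : T1 -> R) (b : T2 -> R) :
  m1.-integrable setT (EFin \o a) -> m2.-integrable setT (EFin \o b) ->
  (m1 \x m2)%E.-integrable setT (EFin \o (fun z => a z.1 * b z.2)).
Proof.
move=> ia ib.
have ma : measurable_fun setT a by apply/measurable_EFinP; exact: measurable_int ia.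
have mb : measurable_fun setT b by apply/measurable_EFinP; exact: measurable_int ib.
apply/integrable12ltyP => /=.
  apply/measurable_EFinP; apply: measurable_funM.
    by apply: measurableT_comp.
  by apply: measurableT_comp.
under eq_integral => x _.
  under eq_integral do rewrite normrM EFinM.
  rewrite ge0_integralZl//; first over.
  by do 2 apply: measurableT_comp => //; exact/measurable_EFinP.
have /integrableP[_ iao] := ia; have /integrableP[_ ibo] := ib.
rewrite ge0_integralZr//.
- by rewrite lte_mul_pinfty// ?integral_ge0// ge0_fin_numE ?integral_ge0.
- by do 2 apply: measurableT_comp => //; exact/measurable_EFinP.
- exact: integral_ge0.
Qed.

End real_fubini.

(** * The compact space of extended real pairs *)

Section extended_plane.
Context {R : realType}.
Implicit Types (F : \bar R * \bar R -> R) (z : \bar R * \bar R) (w : R * R).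

(** The inverse of [contract] is an isometry of [-1, 1] onto the extended
    line, by definition of the metric of the latter. *)
Lemma compact_ereal : compact [set: \bar R].
Proof.
have -> : [set: \bar R] = [set expand x | x in `[-1, 1]%classic].
  apply/seteqP; split => // x _; exists (contract x); last exact: contractK.
  by rewrite /= in_itv/= -ler_norml contract_le1.
apply: continuous_compact; last exact: segment_compact.
apply/subspace_continuousP => x; rewrite /= in_itv/= -ler_norml => x1.
apply/cvg_ballP => e e0; near=> y.
have y1 : `|y| <= 1.
  suff : y \in `[-1, 1] by rewrite in_itv/= -ler_norml.
  by near: y; exact: withinT.
rewrite /ball/= /ereal_ball !expandK ?inE// .
near: y; apply: cvg_within; exact: (@nbhsx_ballx _ R^o x e e0).
Unshelve. all: end_near. Qed.

Lemma compact_ereal2 : compact [set: \bar R * \bar R].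
Proof. by rewrite -setXTT; apply: compact_setX; exact: compact_ereal. Qed.

Lemma continuous_ereal2_bounded F : continuous F ->
  exists2 C, 0 <= C & forall z, `|F z| <= C.
Proof.
move=> cF.
have : compact (F @` setT).
  by apply: continuous_compact; [exact: continuous_subspaceT|exact: compact_ereal2].
move=> /compact_bounded[M [Mr FM]].
exists (`|M| + 1); first by rewrite addr_ge0.
by move=> z; apply: FM; [rewrite ltr_pwDr// ler_norm|exists z].
Qed.

(** Heine's theorem, for the metric of the compactification. *)
Lemma continuous_ereal2_uniform F (e : R) : continuous F -> 0 < e ->
  \forall d \near 0^'+, forall z z', ball z d z' -> `|F z - F z'| < e.
Proof.
move=> cF e0; pose P (d : R) z := forall z', ball z d z' -> `|F z - F z'| < e.
suff : \forall d \near 0^'+, setT `<=` P d.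
  by apply: filterS => d dP z z'; apply: dP.
apply: (compact_near_coveringP _).1 compact_ereal2 _ _ _ _ _ => z _.
have := cF z; move=> /cvgrPdist_lt/(_ _ (divr_gt0 e0 (ltr0n _ 2))).
move=> /nbhs_ballP[d /= d0 dF].
(* half of the radius goes to the centre of the covering, half to the pair *)
exists (ball z (d / 2), [set t | t < d / 2]).
  split; first by apply: nbhsx_ballx; exact: divr_gt0.
  by apply: nbhs_right_lt; exact: divr_gt0.
move=> [y t] [/= zy td] z' yz'; rewrite (splitr e).
rewrite -(subrK (F z) (F y)) -addrA (le_lt_trans (ler_normD _ _))//.
rewrite ltrD ?dF// 1?distrC ?dF//.
  by apply: le_ball zy; rewrite ler_pdivrMr// ler_pMr// ?ler1n.
by rewrite (splitr d); apply: (ball_triangle zy); exact: le_ball (ltW td) _ yz'.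
Qed.

(** The translation of the plane by [-w], extended to the points at
    infinity. *)
Definition eshift z w : \bar R * \bar R := (z.1 - w.1%:E, z.2 - w.2%:E)%E.

Lemma eshiftD z w v : eshift (eshift z w) v = eshift z (v + w).
Proof.
rewrite /eshift/=; congr pair.
    by rewrite opprD EFinD addeA addeAC.
by rewrite opprD EFinD addeA addeAC.
Qed.

Lemma eshift0 z : eshift z 0 = z.
Proof. by case: z => x y; rewrite /eshift/= !sube0. Qed.

Lemma cvg_eshift (T : Type) (U : set_system T) (FU : Filter U)
    (f : T -> \bar R * \bar R) (g : T -> R * R) z w :
  f @ U --> z -> g @ U --> w ->
  eshift (f x) (g x) @[x --> U] --> eshift z w.
Proof.
move=> fz gw.
have f1 : (fun x => (f x).1) @ U --> z.1 by apply: (cvg_comp _ _ fz); exact: cvg_fst.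
have f2 : (fun x => (f x).2) @ U --> z.2 by apply: (cvg_comp _ _ fz); exact: cvg_snd.
have g1 : (fun x => (g x).1) @ U --> w.1 by apply: (cvg_comp _ _ gw); exact: cvg_fst.
have g2 : (fun x => (g x).2) @ U --> w.2 by apply: (cvg_comp _ _ gw); exact: cvg_snd.
apply: cvg_pair.
  apply: cvgeB => //; first by rewrite fin_num_adde_defl.
  by apply: cvg_EFin; [exact: nearW|exact: g1].
apply: cvgeB => //; first by rewrite fin_num_adde_defl.
by apply: cvg_EFin; [exact: nearW|exact: g2].
Qed.

(** Translations move all points of the extended plane by uniformly little:
    continuity of the translation jointly in the point and the vector, made
    uniform by compactness. *)
Lemma continuous_eshift_uniform F (e : R) : continuous F -> 0 < e ->
  \forall w \near (0 : R * R), forall z, `|F (eshift z w) - F z| < e.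
Proof.
move=> cF e0; pose P w z := `|F (eshift z w) - F z| < e.
suff : \forall w \near (0 : R * R), setT `<=` P w.
  by apply: filterS => w wP z; exact: wP.
have cov := (compact_near_coveringP _).1 compact_ereal2.
apply: (cov _ (nbhs (0 : R * R)) P _) => z _.
pose FF := filter_prod (nbhs z) (nbhs (0 : R * R)).
have fFF : Filter FF by exact: filter_prod_filter.
have c1 : F (eshift x.1 x.2) @[x --> FF] --> F z.
  apply: continuous_cvg; first exact: cF.
  rewrite -[X in _ --> X]eshift0; apply: cvg_eshift.
    exact: cvg_fst.
  exact: cvg_snd.
have c2 : F x.1 @[x --> FF] --> F z.
  by apply: continuous_cvg; [exact: cF|exact: cvg_fst].
have := cvgB c1 c2; rewrite subrr => c0.
have H := (cvgr0Pnorm_lt _).1 (c0 fFF) e e0; exact: (H fFF).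

Qed.

(** The extended plane is first countable. *)
Lemma continuous_ereal2_seq F :
  (forall z (u : nat -> \bar R * \bar R), u @ \oo --> z ->
     F (u n) @[n --> \oo] --> F z) ->
  continuous F.
Proof.
move=> seqF z; apply/cvgrPdist_lt => e e0; apply: contrapT => nF.
have /choice[u uP] : forall n : nat,
    exists y, ball z (n.+1%:R^-1 : R) y /\ e <= `|F z - F y|.
  move=> n; apply: contrapT => /forallNP H; apply: nF.
  apply: (nbhs_ballP z _).2; exists n.+1%:R^-1 => /=; first by rewrite invr_gt0.
  by move=> y zy; rewrite ltNge; apply/negP => Fy; exact: (H y).
have uz : u @ \oo --> z.
  apply/cvg_ballP => d d0; near=> n.
  apply: (le_ball _ (uP n).1); apply: ltW; near: n.
  exact: near_infty_natSinv_lt (PosNum d0).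
have /cvgrPdist_lt/(_ _ e0) := seqF z u uz.
move=> [N _ /(_ N (leqnn N))]; rewrite ltNge => /negP; apply.
exact: (uP N).2.
Unshelve. all: end_near. Qed.

Lemma ereal_real_seq (x : \bar R) : exists u : nat -> R,
  (u n)%:E @[n --> \oo] --> x.
Proof.
exists (fun n => fine (ereal_loc_seq x n)).
have -> : (fun n => (fine (ereal_loc_seq x n))%:E) = ereal_loc_seq x.
  by apply/funext => n; case: x.
by apply: (cvg_trans (@cvg_ereal_loc_seq _ x)); exact: ereal_dnbhs_le.
Qed.

End extended_plane.

(** * Integrable functions of the plane *)

Section plane.
Context {R : realType}.
Local Notation mR := (measurableTypeR R).
Local Notation mR2 := (measurableTypeR R * measurableTypeR R)%type.
Local Notation mu := (@lebesgue_measure R).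
Local Notation leb2 := (@leb2 R).
Implicit Types f g h : R * R -> R.

(** Squares of radius [1/(n+1)] centred at rational points form a countable
    basis, which bridges the product topology and the product sigma-algebra. *)
Lemma measurable_open2 (U : set (R * R)) : open U -> @measurable _ mR2 U.
Proof.
move=> oU.
pose B (q : rat * rat * nat) : set (R * R) :=
  ball (ratr q.1.1 : R) (q.2.+1%:R^-1) `*` ball (ratr q.1.2 : R) (q.2.+1%:R^-1).
pose D := [set q | B q `<=` U].
have -> : U = \bigcup_q (if `[< D q >] then B q else set0).
  apply/seteqP; split => [z Uz|z [q _]]; last by case: asboolP => // Dq; exact: Dq.
  have /nbhs_ballP[e /= e0 eU] : nbhs z U by exact: open_nbhs_nbhs.
  have [n _ /(_ n (leqnn n)) ne] :=
    near_infty_natSinv_lt (PosNum (divr_gt0 e0 (ltr0n _ 2))).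
  have {}ne : n.+1%:R^-1 < e / 2 := ne.
  have n0 : 0 < n.+1%:R^-1 :> R by rewrite invr_gt0.
  have ex (x : R) : exists q : rat, ball (ratr q : R) (n.+1%:R^-1) x.
    have x0 : ball x n.+1%:R^-1 !=set0 by exists x; exact: ballxx.
    have [r [xr [q _ qr]]] := dense_rat x0 (ball_open x (n.+1%:R^-1)).
    by exists q; rewrite qr; exact: ball_sym.
  have [q1 q1z] := ex z.1; have [q2 q2z] := ex z.2.
  exists (q1, q2, n) => //; case: asboolP => [_|[]]; first by split.
  have small x y (q : R) : ball q n.+1%:R^-1 x -> ball q n.+1%:R^-1 y ->
      ball x e (y : R).
    move=> qx qy; apply: (@le_ball _ _ _ (n.+1%:R^-1 + n.+1%:R^-1)).
      by rewrite (splitr e) lerD// ltW.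
    by apply: ball_triangle qy; exact: ball_sym.
  by move=> y [y1 y2]; apply: eU; split; [exact: small y1|exact: small y2].
apply: countable_bigcupT_measurable => [|q]; first exact: countableP.
case: asboolP => // _; apply: measurableX; exact: measurable_ball.
Qed.

Lemma continuous_measurable_fun2 f : continuous f -> measurable_fun [set: mR2] f.
Proof.
move=> cf; apply: (measurability _ (RGenOpens.measurableE R)).
move=> _ [_ [a [b ->] <-]]; rewrite setTI; apply: measurable_open2.
by move/continuousP : cf; apply; exact: interval_open.
Qed.

Lemma L1_measurable g : L1 g -> measurable_fun [set: mR2] g.
Proof. by move=> L1g; apply/measurable_EFinP; exact: measurable_int L1g. Qed.

Lemma normL1E g : normL1 g = \int[leb2]_z `|g z|.
Proof. by rewrite /normL1 Lnorm1. Qed.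

Lemma L1_norm g : L1 g -> L1 (fun z => `|g z|).
Proof. exact: integrable_norm. Qed.

Lemma L1_scale (a : R) g : L1 g -> L1 (fun z => a * g z).
Proof.
move=> L1g; apply: eq_integrable (integrableZl measurableT a L1g) => //.
Qed.

Lemma L1D f g : L1 f -> L1 g -> L1 (fun z => f z + g z).
Proof.
move=> L1f L1g; apply: eq_integrable (integrableD measurableT L1f L1g) => //.
Qed.

Lemma L1_sum (I : Type) (s : seq I) (f_ : I -> R * R -> R) :
  (forall i, L1 (f_ i)) -> L1 (fun z => \sum_(i <- s) f_ i z).
Proof.
move=> L1f; elim: s => [|i s IH].
  by under eq_fun do rewrite big_nil; exact: integrable0.
by under eq_fun do rewrite big_cons; exact: L1D.
Qed.

Lemma iintE g : L1 g -> iint g = \int[leb2]_z g z.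
Proof. by move=> L1g; rewrite /iint /Rintegral -(integral12_prod_meas1 L1g). Qed.

Lemma L1_affine (a : R) b g : 0 < a -> L1 g ->
  L1 (g \o affine2 a b) /\
  \int[leb2]_z g (affine2 a b z) = a^-2 * \int[leb2]_z g z.
Proof.
move=> a0 L1g; have mg := L1_measurable L1g.
have mga : measurable_fun [set: mR2] (g \o affine2 a b).
  by apply: measurableT_comp => //; exact: measurable_affine2.
have /integrableP[mEg fing] := L1g; split.
  apply/integrableP; split; first exact/measurable_EFinP.
  rewrite (@ge0_integral_affine2 _ a b (abse \o (EFin \o g)))//.
    by rewrite lte_mul_pinfty ?lee_fin ?invr_ge0 ?exprn_ge0 ?ltW.
    exact: measurableT_comp.
  by move=> z; exact: abse_ge0.
have fp := integrable_pos_fin_num measurableT L1g.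
have fn := integrable_neg_fin_num measurableT L1g.
have ep : (\int[leb2]_z (fun z => (g (affine2 a b z))%:E)^\+ z =
    (a^-2)%:E * \int[leb2]_z (EFin \o g)^\+ z)%E.
  rewrite -(@ge0_integral_affine2 _ a b (EFin \o g)^\+%E)//.
    by rewrite (funepos_comp (EFin \o g) (affine2 a b)).
  exact: measurable_funepos.
have en : (\int[leb2]_z (fun z => (g (affine2 a b z))%:E)^\- z =
    (a^-2)%:E * \int[leb2]_z (EFin \o g)^\- z)%E.
  rewrite -(@ge0_integral_affine2 _ a b (EFin \o g)^\-%E)//.
    by rewrite (funeneg_comp (EFin \o g) (affine2 a b)).
  exact: measurable_funeneg.
rewrite /Rintegral [X in fine X = _]integralE ep en [X in _ = _ * fine X]integralE.
rewrite -muleBr ?fin_num_adde_defl ?fin_numN// fineM//.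
by rewrite fin_numB fp fn.
Qed.

End plane.

(** * Averaging a function of the extended plane against an L1 function *)

Section smear.
Context {R : realType}.
Local Notation mR := (measurableTypeR R).
Local Notation mR2 := (measurableTypeR R * measurableTypeR R)%type.
Local Notation mu := (@lebesgue_measure R).
Local Notation leb2 := (@leb2 R).
Implicit Types (F Phi : \bar R * \bar R -> R) (g h : R * R -> R).

(** The convolution of [Phi] with [g]. It is applied to a continuous primitive
    and to the discontinuous indicator of a quadrant. *)
Definition smear Phi g : \bar R * \bar R -> R :=
  fun z => \int[leb2]_w (Phi (eshift z w) * g w).

(** Measurability is asked along the translates of each point of the extended
    plane by real vectors, which also makes sense at infinity. *)
Definition smearable (C : R) Phi := (forall z, `|Phi z| <= C) /\
  forall z, measurable_fun [set: mR2] (fun w => Phi (eshift z w)).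

Lemma smear_integrable C Phi g z : smearable C Phi -> L1 g ->
  L1 (fun w => Phi (eshift z w) * g w).
Proof.
move=> [PhiC mPhi] L1g.
by apply: (@integrable_bounded_mul _ _ _ leb2 _ g C).
Qed.

Lemma smear_bound C Phi g z : smearable C Phi -> L1 g ->
  `|smear Phi g z| <= C * normL1 g.
Proof.
move=> sPhi L1g; have [PhiC mPhi] := sPhi.
rewrite normL1E -RintegralZl//; last exact: L1_norm.
apply: normr_Rintegral_le.
- by apply: measurable_funM => //; exact: L1_measurable.
- by apply: L1_scale; exact: L1_norm.
- by move=> w; rewrite normrM ler_wpM2r.
Qed.

Lemma smearB C C' Phi Phi' g : smearable C Phi -> smearable C' Phi' -> L1 g ->
  smear (fun z => Phi z - Phi' z) g = fun z => smear Phi g z - smear Phi' g z.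
Proof.
move=> sP sP' L1g; apply/funext => z; rewrite /smear -RintegralB//.
- by under eq_Rintegral do rewrite mulrBl.
- exact: smear_integrable sP L1g.
- exact: smear_integrable sP' L1g.
Qed.

(** The average inherits continuity even from a discontinuous function, as
    long as almost every translate of it is continuous at the point. *)
Lemma smear_continuous C Phi g : smearable C Phi -> L1 g ->
  (forall z, {ae leb2, forall w, Phi x @[x --> eshift z w] --> Phi (eshift z w)}) ->
  continuous (smear Phi g).
Proof.
move=> sPhi L1g cPhi; have [PhiC mPhi] := sPhi.
apply: continuous_ereal2_seq => z u uz.
apply: (@Rintegral_dominated_cvg _ _ _ leb2 _ _ (fun w => C * `|g w|)).
- by move=> n; apply: measurable_funM => //; exact: L1_measurable.
- by apply: measurable_funM => //; exact: L1_measurable.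
- by apply: L1_scale; exact: L1_norm.
- by move=> n w; rewrite normrM ler_wpM2r.
apply: filterS (cPhi z) => w cw; apply: cvgMl.
by apply: (cvg_comp _ _ _ cw); apply: cvg_eshift => //; exact: cvg_cst.
Qed.

Lemma smearable_continuous C F : continuous F -> (forall z, `|F z| <= C) ->
  smearable C F.
Proof.
move=> cF FC; split => // z; apply: continuous_measurable_fun2 => w.
apply: (cvg_comp (eshift z) F); last exact: cF.
by apply: cvg_eshift; [exact: cvg_cst|exact: cvg_id].
Qed.

Lemma eshiftNyl (s : \bar R) (w : R * R) : exists s', eshift (-oo%E, s) w = (-oo%E, s').
Proof. by exists (s - w.2%:E)%E; rewrite /eshift. Qed.

Lemma eshiftNyr (s : \bar R) (w : R * R) : exists s', eshift (s, -oo%E) w = (s', -oo%E).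
Proof. by exists (s - w.1%:E)%E; rewrite /eshift. Qed.

Lemma smear_edge Phi g :
  (forall s, Phi (-oo%E, s) = 0 /\ Phi (s, -oo%E) = 0) ->
  forall s, smear Phi g (-oo%E, s) = 0 /\ smear Phi g (s, -oo%E) = 0.
Proof.
move=> Phi0 s; split; rewrite /smear.
  under eq_Rintegral => w _.
    by have [s' ->] := eshiftNyl s w; rewrite (Phi0 s').1 mul0r over.
  by rewrite Rintegral_cst// mul0r.
under eq_Rintegral => w _.
  by have [s' ->] := eshiftNyr s w; rewrite (Phi0 s').2 mul0r over.
by rewrite Rintegral_cst// mul0r.
Qed.

(** The points at minus infinity are fixed by real translations. *)
Lemma smear_Bc F g : Bc F -> L1 g -> Bc (smear F g).
Proof.
move=> [cF F0] L1g; split; last exact: smear_edge.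
have [C C0 FC] := continuous_ereal2_bounded cF.
apply: (smear_continuous (smearable_continuous cF FC) L1g) => z.
by apply: aeW => w; exact: cF.
Qed.

End smear.

(** * Convolution of integrable functions *)

Section convolution.
Context {R : realType}.
Local Notation mR := (measurableTypeR R).
Local Notation mR2 := (measurableTypeR R * measurableTypeR R)%type.
Local Notation mu := (@lebesgue_measure R).
Local Notation leb2 := (@leb2 R).
Implicit Types (F Phi : \bar R * \bar R -> R) (g h : R * R -> R).

(** No integrability is assumed, so that the iterated integral defining a
    convolution is seen to be measurable on its exceptional set too. *)
Lemma measurable_integral2 d1 d2 (T1 : measurableType d1) (T2 : measurableType d2)
    (m2 : {sigma_finite_measure set T2 -> \bar R}) (f : T1 * T2 -> \bar R) :
  measurable_fun setT f ->
  measurable_fun setT (fun x => \int[m2]_y f (x, y))%E.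
Proof.
move=> mf.
have -> : ((fun x => \int[m2]_y f (x, y)) =
    (fun x => \int[m2]_y f^\+ (x, y)) \- (fun x => \int[m2]_y f^\- (x, y)))%E.
  apply/funext => x; rewrite [LHS]integralE; congr (_ - _)%E.
    by apply: eq_integral => y _; rewrite funepos_comp.
  by apply: eq_integral => y _; rewrite funeneg_comp.
apply: emeasurable_funB; apply: measurable_fun_fubini_tonelli_F => //.
  exact: measurable_funepos.
exact: measurable_funeneg.
Qed.

Lemma measurable_iint (K : mR2 * mR2 -> R) : measurable_fun setT K ->
  measurable_fun [set: mR2] (fun u => iint (fun v => K (u, v))).
Proof.
move=> mK; apply: (measurableT_comp (fine_measurable measurableT)).
apply: (@measurable_integral2 _ _ mR2 mR mu
  (fun us => \int[mu]_t (K (us.1, (us.2, t)))%:E)%E).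
apply: (@measurable_integral2 _ _ (mR2 * mR)%type mR mu
  (fun ust => (K (ust.1.1, (ust.1.2, ust.2)))%:E)).
apply/measurable_EFinP; apply: (measurableT_comp mK).
apply: measurable_fun_pair; first exact: measurableT_comp.
by apply: measurable_fun_pair => //; exact: measurableT_comp.
Qed.

Definition conv_kernel g h (p : mR2 * mR2) : R :=
  g (p.1.1 - p.2.1, p.1.2 - p.2.2) * h p.2.

Lemma measurable_conv_kernel g h :
  measurable_fun [set: mR2] g -> measurable_fun [set: mR2] h ->
  measurable_fun setT (conv_kernel g h).
Proof.
move=> mg mh; apply: measurable_funM; last exact: measurableT_comp.
apply: (measurableT_comp mg).
by apply: measurable_fun_pair; apply: measurable_funB; do 2 apply: measurableT_comp => //.
Qed.

Lemma conv_kernel_affine g h (u v : R * R) :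
  conv_kernel g h (u, v) = g (affine2 1 (- v.1, - v.2) u) * h v.
Proof. by rewrite /conv_kernel /affine2/= !mul1r. Qed.

(** Integrating first the translated factor makes the double integral split
    into a product of norms. *)
Lemma integrable_conv_kernel g h : L1 g -> L1 h ->
  (leb2 \x leb2)%E.-integrable setT (EFin \o conv_kernel g h).
Proof.
move=> L1g L1h; have mg := L1_measurable L1g; have mh := L1_measurable L1h.
have mK := measurable_conv_kernel mg mh.
have mEK : measurable_fun setT (EFin \o conv_kernel g h) by exact/measurable_EFinP.
apply/(integrable21ltyP leb2 leb2 mEK).
rewrite (eq_integral (fun v : mR2 => `|(h v)%:E| * \int[leb2]_u `|(g u)%:E|)%E); last first.
  move=> v _; under eq_integral => u _.
    rewrite /= conv_kernel_affine normrM EFinM muleC; over.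
  rewrite /= ge0_integralZl//; last first.
    do 2 apply: measurableT_comp => //.
    by apply: measurableT_comp => //; exact: measurable_affine2.
  rewrite (@ge0_integral_affine2 _ 1 (- v.1, - v.2) (fun u => `|(g u)%:E|)%E)//.
    by rewrite expr1n invr1 mul1e.
  by do 2 apply: measurableT_comp => //.
have /integrableP[_ gfin] := L1g; have /integrableP[_ hfin] := L1h.
rewrite ge0_integralZr//; last 2 first.
- by do 2 apply: measurableT_comp => //.
- exact: integral_ge0.
by rewrite lte_mul_pinfty ?integral_ge0// ge0_fin_numE ?integral_ge0.
Qed.

Lemma convL1_ae g h : L1 g -> L1 h ->
  {ae leb2, forall u, convL1 g h u = \int[leb2]_v conv_kernel g h (u, v)}.
Proof.
move=> L1g L1h.
apply: filterS (ae_integrable1 (integrable_conv_kernel L1g L1h)) => u iu.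
by rewrite -iintE.
Qed.

Lemma measurable_convL1 g h : L1 g -> L1 h ->
  measurable_fun [set: mR2] (convL1 g h).
Proof.
move=> L1g L1h; apply: (measurable_iint (K := conv_kernel g h)).
by apply: measurable_conv_kernel; exact: L1_measurable.
Qed.

Lemma L1_convL1 g h : L1 g -> L1 h -> L1 (convL1 g h).
Proof.
move=> L1g L1h; have iK := integrable_conv_kernel L1g L1h.
have [iJ _] := integrable_fine (integrable_fubini_F iK).
have mc := measurable_convL1 L1g L1h.
apply/integrableP; split; first exact/measurable_EFinP.
have /integrableP[mJ] := iJ; apply: le_lt_trans.
rewrite le_eqVlt; apply/orP; left; apply/eqP; apply: ae_eq_integral => //.
- by do 2 apply: measurableT_comp => //.
- exact: measurableT_comp.
by apply: filterS (convL1_ae L1g L1h) => u /= ->.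
Qed.

(** Associativity, for an average [Phi * g] that need not be continuous: it is
    used both for primitives and for the indicator of a quadrant. *)
Lemma smear_smear C Phi g h : smearable C Phi -> L1 g -> L1 h ->
  smear (smear Phi g) h = smear Phi (convL1 g h).
Proof.
move=> sPhi L1g L1h; have [PhiC mPhi] := sPhi; apply/funext => z.
have iK := integrable_conv_kernel L1g L1h.
pose K (p : mR2 * mR2) : R := Phi (eshift z p.1) * conv_kernel g h p.
have iPK : (leb2 \x leb2)%E.-integrable setT (EFin \o K).
  apply: (@integrable_bounded_mul _ _ _ _ _ _ C) => //.
  by apply: (measurableT_comp (mPhi z)).
transitivity (\int[(leb2 \x leb2)%E]_p K p).
  rewrite (Rfubini2 iPK); apply: eq_Rintegral => v _.
  (* the substitution u = w + v *)
  have -> : smear Phi g (eshift z v) =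
      \int[leb2]_u (Phi (eshift z u) * g (affine2 1 (- v.1, - v.2) u)).
    have L1gv := (L1_affine (- v.1, - v.2) ltr01 L1g).1.
    have := (L1_affine v ltr01 (smear_integrable z sPhi L1gv)).2.
    rewrite expr1n invr1 mul1r => <-.
    apply: eq_Rintegral => w _; rewrite eshiftD /affine2/= !mul1r !addrK.
    by case: w.
  rewrite -RintegralZr//; last first.
    apply: (smear_integrable z sPhi).
    exact: (L1_affine (- v.1, - v.2) ltr01 L1g).1.
  apply: eq_Rintegral => u _; by rewrite /K conv_kernel_affine mulrA.
rewrite (Rfubini1 iPK); rewrite /smear /Rintegral; congr fine.
have sc := smear_integrable z sPhi (L1_convL1 L1g L1h).
have [iJ _] := integrable_fine (integrable_fubini_F iPK).
apply: ae_eq_integral => //.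
- exact: measurable_int iJ.
- exact: measurable_int sc.
apply: filterS2 (convL1_ae L1g L1h) (ae_integrable1 iK) => u ju iu _ /=.
rewrite ju -RintegralZl//.
Qed.

End convolution.

(** * Test functions and distributions *)

Section test_functions.
Context {R : realType}.
Local Notation mR := (measurableTypeR R).
Local Notation mR2 := (measurableTypeR R * measurableTypeR R)%type.
Local Notation mu := (@lebesgue_measure R).
Local Notation leb2 := (@leb2 R).
Implicit Types (phi : testFun R) (T : testFun R -> R) (g G : R * R -> R).

Lemma testFun_smooth phi : smooth (val phi).
Proof. by have := valP phi; rewrite unfold_in => /asboolP[]. Qed.

Lemma testFun_compact phi : compact (tsupport (val phi)).
Proof. by have := valP phi; rewrite unfold_in => /asboolP[]. Qed.

Lemma testFun_continuous phi : continuous (val phi).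
Proof. by have [] := testFun_smooth phi [::]. Qed.

Arguments testFun_smooth : clear implicits.
Arguments testFun_compact : clear implicits.
Arguments testFun_continuous : clear implicits.

Lemma tsupport_pd b (f : R * R -> R) : tsupport (pd b f) `<=` tsupport f.
Proof.
have clf : closed (tsupport f) by exact: closed_closure.
rewrite [X in _ `<=` X](closure_id _).1//; apply: closure_subset => y /= pdy.
apply: contrapT => ny; move/eqP : pdy; apply.
(* off the support, the function vanishes nearby and so does its derivative *)
have near0 : \near y, f y = cst 0 y.
  have : nbhs y (~` tsupport f).
    by apply: open_nbhs_nbhs; split => //; exact: closed_openC.
  by apply: filterS => t /notin_support ->.
by rewrite /pd (near_eq_derive _ near0) (derive_cst (0 : R)).
Qed.

(** Supports are controlled by squares, on which both variables separate. *)
Definition box (M : R) : set (R * R) := [set z | `|z.1| <= M /\ `|z.2| <= M].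

Lemma compact_box (K : set (R * R)) : compact K -> exists2 M, 0 < M & K `<=` box M.
Proof.
move=> /compact_bounded[M [Mr KM]]; exists (`|M| + 1); first by rewrite ltr_wpDl.
move=> z Kz; have := KM (`|M| + 1); rewrite ltr_pwDr// ?ler_norm// => /(_ isT z Kz) /=.
by rewrite prod_normE ge_max => /andP[].
Qed.

Lemma testFun_box phi : exists2 M, 0 < M & forall z, ~ box M z -> val phi z = 0.
Proof.
have [M M0 phiM] := compact_box (testFun_compact phi).
by exists M => // z nMz; apply: notin_support => /phiM.
Qed.

Lemma box_itv M : box M = `[- M, M]%classic `*` `[- M, M]%classic.
Proof.
by apply/seteqP; split => -[x y]; rewrite /box/= !in_itv/= -!ler_norml.
Qed.

Lemma measurable_box M : @measurable _ mR2 (box M).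
Proof. by rewrite box_itv; apply: measurableX. Qed.

Lemma L1_box M : L1 (\1_(box M) : R * R -> R).
Proof.
have -> : (\1_(box M) : R * R -> R) =
    fun z => \1_(`[- M, M]%classic : set R) z.1 * \1_(`[- M, M]%classic : set R) z.2.
  apply/funext => z; rewrite box_itv !indicE -natrM mulnb; congr (_%:R); congr nat_of_bool.
  by rewrite in_setX.
by apply: (@integrable_tensor _ _ mR mR _ mu mu); exact: integrable_indic_itv.
Qed.

Definition locally_L1 G := forall M, L1 (fun z => \1_(box M) z * G z).

Lemma bounded_locally_L1 G C : measurable_fun [set: mR2] G ->
  (forall z, `|G z| <= C) -> locally_L1 G.
Proof.
move=> mG GC M; under eq_fun do rewrite mulrC.
exact: (@integrable_bounded_mul _ _ _ leb2 G _ C _ _ (L1_box M)).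
Qed.

Lemma continuous_bounded_box (f : R * R -> R) M : continuous f ->
  (forall z, ~ box M z -> f z = 0) -> exists C, forall z, `|f z| <= C.
Proof.
move=> cf f0.
have : compact (f @` box M).
  apply: continuous_compact; first exact: continuous_subspaceT.
  by rewrite box_itv; apply: compact_setX; exact: segment_compact.
move=> /compact_bounded[C [Cr fC]]; exists (`|C| + 1) => z.
have [bz|/f0 ->] := pselect (box M z); last by rewrite normr0 addr_ge0.
by apply: fC; [rewrite ltr_pwDr// ler_norm|exists z].
Qed.

Lemma locally_L1_mul G (f : R * R -> R) M : locally_L1 G -> continuous f ->
  (forall z, ~ box M z -> f z = 0) -> L1 (fun z => G z * f z).
Proof.
move=> LG cf f0; have [C fC] := continuous_bounded_box cf f0.
have -> : (fun z => G z * f z) = (fun z => f z * (\1_(box M) z * G z)).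
  apply/funext => z; have [bz|nbz] := pselect (box M z).
    by rewrite indicE mem_set// mul1r mulrC.
  by rewrite f0// mulr0 mul0r.
apply: (@integrable_bounded_mul _ _ _ leb2 f _ C) => //.
  exact: continuous_measurable_fun2.
exact: LG.
Qed.

Lemma regular_distr_integrable G phi : locally_L1 G ->
  L1 (fun z => G z * val phi z).
Proof.
move=> LG; have [M _ phi0] := testFun_box phi.
by apply: locally_L1_mul phi0 => //; exact: testFun_continuous.
Qed.

Lemma testFun_L1 phi : L1 (val phi).
Proof.
have -> : val phi = fun z => cst 1 z * val phi z by apply/funext => z; rewrite mul1r.
apply: regular_distr_integrable; apply: (@bounded_locally_L1 (cst 1) 1) => //.
by move=> z; rewrite normr1.
Qed.

(** Convergent test functions live in a common box, on which uniform
    convergence is integrated against [G]. *)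
Lemma regular_distr_distribution G : locally_L1 G -> distributions (regular_distr G).
Proof.
move=> LG; split.
  move=> a phi psi; rewrite /regular_distr -RintegralZl//; last first.
    exact: regular_distr_integrable.
  rewrite -RintegralD//.
  - by apply: eq_Rintegral => z _; rewrite mulrDr mulrCA.
  - by apply: L1_scale; exact: regular_distr_integrable.
  - exact: regular_distr_integrable.
move=> u phi [[K cK uK] /(_ [::]) ucv].
have [M M0 KM] := compact_box cK.
have [M' M'0 phiM'] := testFun_box phi.
pose N := Num.max M M'.
have sub a : a <= N -> box a `<=` box N.
  by move=> aN z [z1 z2]; split; exact: le_trans aN.
have out n z : ~ box N z -> val (u n) z - val phi z = 0.
  move=> nz; rewrite phiM' ?subr0; last first.
    by move=> bz; apply: nz; apply: sub bz; rewrite le_max lexx orbT.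
  apply: notin_support => /uK/KM bz; apply: nz; apply: sub bz.
  by rewrite le_max lexx.
pose J := \int[leb2]_z `|\1_(box N) z * G z|.
have J0 : 0 <= J by exact: Rintegral_ge0.
apply/cvgrPdist_le => e e0.
have eI : 0 < e / (J + 1) by rewrite divr_gt0// ltr_wpDl.
have un : \forall n \near \oo, forall z, `|val (u n) z - val phi z| < e / (J + 1).
  have := ucv [set h | forall z, `|h z - val phi z| < e / (J + 1)].
  apply; apply/uniform_nbhs.
  exists [set xy | `|xy.1 - xy.2| < e / (J + 1)]; split.
    exists (e / (J + 1)) => //=.
  by move=> h hE z; rewrite distrC; exact: (hE z I).
near=> n.
have unz : forall z, `|val (u n) z - val phi z| < e / (J + 1) by near: n.
rewrite distrC /regular_distr -RintegralB//; last 2 first.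
- exact: regular_distr_integrable.
- exact: regular_distr_integrable.
apply: (@le_trans _ _ (\int[leb2]_z (e / (J + 1) * `|\1_(box N) z * G z|))).
  apply: normr_Rintegral_le.
  - by apply: L1_measurable; have := L1D (regular_distr_integrable (u n) LG)
      (L1_scale (-1) (regular_distr_integrable phi LG));
      under eq_fun do rewrite mulN1r.
  - by apply: L1_scale; exact: L1_norm.
  - move=> z; rewrite -mulrBr; have [bz|nbz] := pselect (box N z).
      rewrite indicE mem_set// mul1r normrM mulrC ler_wpM2r//.
      exact: ltW.
    by rewrite out// mulr0 normr0 mulr_ge0// ltW.
rewrite RintegralZl//; last exact: L1_norm.
by rewrite -/J mulrAC ler_pdivrMr ?ler_wpM2l ?lerDl ?ltW// ltr_wpDl.
Unshelve. all: end_near. Qed.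

Lemma cvg_testFun_pd b (u : nat -> testFun R) phi :
  cvg_testFun u phi -> cvg_testFun (fun n => tpd b (u n)) (tpd b phi).
Proof.
move=> [[K cK uK] ucv]; split.
  by exists K => // n; apply: subset_trans (uK n); exact: tsupport_pd.
move=> w; have := ucv (w ++ [:: b]); rewrite -pds_cat.
by under [X in X @ _]eq_fun do rewrite -pds_cat.
Qed.

Lemma tpdD b (a : R) phi psi : tpd b (a *: phi + psi) = a *: tpd b phi + tpd b psi.
Proof.
apply: val_inj => /=.
have /= := pdsD [:: b] (testFun_smooth (a *: phi)) (testFun_smooth psi).
by move=> ->; have /= -> := pdsZ [:: b] a (testFun_smooth phi).
Qed.

Lemma dpd_distribution b T : distributions T -> distributions (dpd b T).
Proof.
move=> [linT cT]; split.
  by move=> a phi psi; rewrite /dpd tpdD linT opprD mulrN.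
by move=> u phi /(cvg_testFun_pd b) /cT; exact: cvgN.
Qed.

Lemma d12E T phi : d12 T phi = T (tpd true (tpd false phi)).
Proof. by rewrite /d12 /dpd opprK. Qed.

(** On horizontal and vertical lines the partial derivatives of a test function
    are ordinary derivatives. *)
Lemma is_derive_line2 phi (x y : R) :
  is_derive y 1 (fun t : R => val phi (x, t)) (val (tpd true phi) (x, y)).
Proof.
have [_ /(_ true (x, y)) /= d] := testFun_smooth phi [::].
rewrite /= /pd /derive /derivable /= in d *.
have E : (fun h : R => h^-1 *: (val phi (h *: axis true + (x, y)) - val phi (x, y))) =
    (fun h : R => h^-1 *: (val phi (x, h *: 1 + y) - val phi (x, y))).
  apply/funext => h; rewrite (_ : h *: axis true + (x, y) = (x, h *: 1 + y))//.
  by rewrite /axis; congr pair; rewrite /= [_ *: _]mulr0 add0r.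
rewrite E in d *.
by split.
Qed.

Lemma is_derive_line1 phi (x y : R) :
  is_derive x 1 (fun t : R => val phi (t, y)) (val (tpd false phi) (x, y)).
Proof.
have [_ /(_ false (x, y)) /= d] := testFun_smooth phi [::].
rewrite /= /pd /derive /derivable /= in d *.
have E : (fun h : R => h^-1 *: (val phi (h *: axis false + (x, y)) - val phi (x, y))) =
    (fun h : R => h^-1 *: (val phi (h *: 1 + x, y) - val phi (x, y))).
  apply/funext => h; rewrite (_ : h *: axis false + (x, y) = (h *: 1 + x, y))//.
  by rewrite /axis; congr pair; rewrite /= [_ *: _]mulr0 add0r.
rewrite E in d *.
by split.
Qed.

End test_functions.
Arguments testFun_smooth {R} phi _.
Arguments testFun_compact {R} phi _ _ _.
Arguments testFun_continuous {R} phi _ _ _.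

(** * Integrable functions as derivatives of continuous ones *)

Section quadrant.
Context {R : realType}.
Local Notation mR := (measurableTypeR R).
Local Notation mR2 := (measurableTypeR R * measurableTypeR R)%type.
Local Notation mu := (@lebesgue_measure R).
Local Notation leb2 := (@leb2 R).
Implicit Types (phi : testFun R) (g : R * R -> R).

Definition estep (x : \bar R) : R := (0 <= x)%E%:R.

(** The indicator of a closed quadrant is a fundamental solution of the mixed
    derivative; averaging it against [g] gives the primitive of [g]. *)
Definition quadrant (z : \bar R * \bar R) : R := estep z.1 * estep z.2.

(** The step only jumps at 0. *)
Lemma estep_cvg (x : \bar R) : x != 0%E -> estep y @[y --> x] --> estep x.
Proof.
move=> x0; apply: cvg_near_cst; have [x_lt0|x_ge0] := ltP x 0%E.
  have : nbhs x [set y | (y < 0)%E].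
    by apply: open_nbhs_nbhs; split => //; exact: open_ereal_lt_ereal.
  by apply: filterS => y /= y0; rewrite /estep !leNgt y0 x_lt0.
have x_gt0 : (0 < x)%E by rewrite lt_neqAle eq_sym x0.
have : nbhs x [set y | (0 < y)%E].
  by apply: open_nbhs_nbhs; split => //; exact: open_ereal_gt_ereal.
by apply: filterS => y /= /ltW y0; rewrite /estep y0 x_ge0.
Qed.

Lemma estep_fin (x s : R) : estep (x%:E - s%:E) = \1_(`[s, +oo[%classic : set R) x.
Proof.
rewrite /estep -EFinB lee_fin subr_ge0 indicE; congr (_%:R); congr nat_of_bool.
by apply/idP/idP => [?|]; rewrite ?inE/= in_itv/= ?andbT//.
Qed.

Lemma measurable_estep x : measurable_fun [set: mR] (fun s : mR => estep (x - s%:E)).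
Proof.
case: x => [x| |]; last 2 first.
- exact: measurable_cst.
- exact: measurable_cst.
have -> : (fun s : mR => estep (x%:E - s%:E)) = \1_(`]-oo, x]%classic : set mR).
  apply/funext => s; rewrite /estep -EFinB lee_fin subr_ge0 indicE.
  congr (_%:R); congr nat_of_bool.
  by apply/idP/idP => [?|]; rewrite ?inE/= in_itv/=.
by apply: measurable_indic; exact: measurable_itv.
Qed.

Lemma estep_le1 x : `|estep x| <= 1.
Proof. by rewrite /estep; case: (_ <= _)%E; rewrite ?normr1 ?normr0. Qed.

Lemma smearable_quadrant : smearable 1 quadrant.
Proof.
split=> [z|z]; first by rewrite normrM mulr_ile1// estep_le1.
apply: measurable_funM.
  by apply: (measurableT_comp (measurable_estep z.1)).
by apply: (measurableT_comp (measurable_estep z.2)).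
Qed.

Lemma leb2_lines0 (A B : set mR) : measurable A -> measurable B ->
  mu A = 0%E -> mu B = 0%E ->
  leb2.-negligible [set w | A w.1 \/ B w.2].
Proof.
move=> mA mB A0 B0; have mlines : @measurable _ mR2 (A `*` setT `|` setT `*` B).
  by apply: measurableU; exact: measurableX.
exists (A `*` setT `|` setT `*` B); split => //.
  rewrite null_set_setU//; try exact: measurableX.
    transitivity (mu A * mu setT)%E; first exact: product_measure1E.
    by rewrite A0 mul0e.
  transitivity (mu setT * mu B)%E; first exact: product_measure1E.
  by rewrite B0 mule0.
by move=> w /= [Aw|Bw]; [left|right].
Qed.

Lemma sube_fin_eq0 (x : \bar R) (s : R) : (x - s%:E = 0)%E -> s%:E = x.
Proof. by case: x => [x| |]//= [] /eqP; rewrite subr_eq0 => /eqP ->. Qed.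

(** The translates of the quadrant that are discontinuous at a point are those
    with a side through it: they form a null set. *)
Lemma smear_quadrant_continuous g : L1 g -> continuous (smear quadrant g).
Proof.
move=> L1g; apply: (smear_continuous smearable_quadrant L1g) => z.
have mE (x : \bar R) : measurable [set s : mR | s%:E = x] /\ mu [set s : mR | s%:E = x] = 0%E.
  case: x => [x| |].
  - have -> : [set s : mR | s%:E = x%:E] = [set x].
      by apply/seteqP; split => s /=; [case|move=> ->].
    by split; [exact: measurable_set1|exact: lebesgue_measure_set1].
  - have -> : [set s : mR | s%:E = +oo%E] = set0 by apply/seteqP; split.
    by rewrite measure0; split.
  - have -> : [set s : mR | s%:E = -oo%E] = set0 by apply/seteqP; split.
    by rewrite measure0; split.
have [m1 n1] := mE z.1; have [m2 n2] := mE z.2.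
apply: negligibleS (leb2_lines0 m1 m2 n1 n2) => w /= nw.
apply: contrapT => /not_orP[w1 w2]; apply: nw.
apply: cvgM.
  apply: (cvg_comp _ _ _ (estep_cvg _)); first exact: cvg_fst.
  by apply/eqP => zw; exact/w1/sube_fin_eq0.
apply: (cvg_comp _ _ _ (estep_cvg _)); first exact: cvg_snd.
by apply/eqP => zw; exact/w2/sube_fin_eq0.
Qed.

Lemma smear_quadrant_Bc g : L1 g -> Bc (smear quadrant g).
Proof.
move=> L1g; split; first exact: smear_quadrant_continuous.
by apply: smear_edge => s; rewrite /quadrant /estep/= mul0r mulr0.
Qed.

(** The fundamental theorem of calculus for compactly supported functions. *)
Lemma integral_halfline_derive (k k' : R -> R) (a M : R) :
  (forall y : R, is_derive y 1 k (k' y)) -> continuous k' ->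
  (forall y, M < y -> k y = 0) -> (forall y, M < y -> k' y = 0) ->
  \int[mu]_y (\1_(`[a, +oo[%classic : set R) y * k' y) = - k a.
Proof.
move=> dk ck' k0 k'0; pose B := Num.max M a + 1.
have aB : a < B by rewrite ltr_pwDr// le_max lexx orbT.
have MB : M < B by rewrite ltr_pwDr// le_max lexx.
(* B lies beyond both the support and the left end of the half-line *)
have -> : (fun y => \1_(`[a, +oo[%classic : set R) y * k' y) = k' \_ `[a, B]%classic.
  apply/funext => y; rewrite patchE indicE.
  have [yaB|] := boolP (y \in `[a, B]%classic).
    rewrite mem_set ?mul1r//; move: yaB; rewrite inE/= in_itv/= => /andP[ay _].
    by rewrite in_itv/= ay.
  rewrite notin_setE/= in_itv/= => /negP; rewrite negb_and -!ltNge => /orP[ya|By].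
    by rewrite memNset ?mul0r//= in_itv/= andbT leNgt ya.
  by rewrite k'0 ?mulr0// (lt_trans MB).
rewrite -Rintegral_mkcond /Rintegral (@continuous_FTC2 _ k' k a B)//.
- by rewrite k0// sub0e.
- exact: continuous_subspaceT.
- split.
  + by move=> y _; have [] := dk y.
  + apply: cvg_at_right_filter; apply: differentiable_continuous.
    by apply/derivable1_diffP; have [] := dk a.
  + apply: cvg_at_left_filter; apply: differentiable_continuous.
    by apply/derivable1_diffP; have [] := dk B.
- by move=> y _; rewrite derive1E; have [_ ->] := dk y.
Qed.

Lemma integrable_compact_line (k : R -> R) (A : set mR) (M : R) :
  measurable A -> continuous k -> (forall y, M < `|y| -> k y = 0) ->
  mu.-integrable setT (EFin \o (fun y => \1_A y * k y)).
Proof.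
move=> mA ck k0.
have : compact (k @` `[- M, M]%classic).
  by apply: continuous_compact; [exact: continuous_subspaceT|exact: segment_compact].
move=> /compact_bounded[C [Cr kC]].
apply: (@integrable_bounded_mul _ _ _ mu \1_A k 1).
- exact: measurable_indic.
- by move=> y; rewrite indicE; case: (_ \in _); rewrite ?normr1 ?normr0.
have -> : k = fun y => k y * \1_(`[- M, M]%classic : set R) y.
  apply/funext => y; rewrite indicE; have [yM|yM] := leP `|y| M.
    by rewrite mem_set ?mulr1//= in_itv/= -ler_norml.
  by rewrite k0// mul0r.
apply: (@integrable_bounded_mul _ _ _ mu k _ (`|C| + 1)).
- exact: continuous_measurable_fun.
- move=> y; have [yM|yM] := leP `|y| M; last by rewrite k0// normr0 addr_ge0.
  by apply: kC; [rewrite ltr_pwDr// ler_norm|exists y => //=; rewrite in_itv/= -ler_norml].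
- exact: integrable_indic_itv.
Qed.

(** The fundamental theorem of calculus removes the derivative in the second
    variable, and then the one in the first. *)
Lemma integral_quadrant_testFun phi (w : R * R) :
  \int[leb2]_z (quadrant (eshift (z.1%:E, z.2%:E) w) *
    val (tpd true (tpd false phi)) z) = val phi w.
Proof.
pose psi := tpd true (tpd false phi).
have [M1 _ phi0] := testFun_box phi.
have [M2 _ dphi0] := testFun_box (tpd false phi).
have [M3 _ psi0] := testFun_box psi.
have line (f : R * R -> R) x : continuous f -> continuous (fun y => f (x, y)).
  move=> cf y; have c : (fun t : R => (x, t)) @ y --> (x, y).
    apply: (@cvg_pair _ _ _ (nbhs y) (nbhs x) (nbhs y)); last exact: cvg_id.
    exact: cvg_cst.
  exact: (cvg_comp _ _ c (cf (x, y))).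
have line' (f : R * R -> R) y : continuous f -> continuous (fun x => f (x, y)).
  move=> cf x; have c : (fun t : R => (t, y)) @ x --> (x, y).
    apply: (@cvg_pair _ _ _ (nbhs x) (nbhs x) (nbhs y)); first exact: cvg_id.
    exact: cvg_cst.
  exact: (cvg_comp _ _ c (cf (x, y))).
have nbox2 M x y : M < `|y| -> ~ box M (x, y).
  by move=> My [_ /=]; rewrite leNgt My.
have nbox1 M x y : M < `|x| -> ~ box M (x, y).
  by move=> Mx [/= + _]; rewrite leNgt Mx.
have gtn M (t : R) : M < t -> M < `|t| by move=> /lt_le_trans; apply; exact: ler_norm.
have qE (x y : R) : quadrant (eshift (x%:E, y%:E) w) =
    \1_(`[w.1, +oo[%classic : set R) x * \1_(`[w.2, +oo[%classic : set R) y.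
  by rewrite /quadrant/= !estep_fin.
have iq : L1 (fun z => quadrant (eshift (z.1%:E, z.2%:E) w) * val psi z).
  have [q1 _] := smearable_quadrant.
  apply: (@integrable_bounded_mul _ _ _ leb2 _ _ 1) => //; last exact: testFun_L1.
  under eq_fun do rewrite qE.
  by apply: measurable_funM; apply: measurableT_comp => //; apply: measurable_indic;
    exact: measurable_itv.
rewrite [LHS](@Rfubini1 _ _ mR mR R mu mu _ iq)/=.
transitivity (\int[mu]_x ((- 1) * (\1_(`[w.1, +oo[%classic : set R) x *
    val (tpd false phi) (x, w.2)))).
  apply: eq_Rintegral => x _.
  under eq_Rintegral => y _ do rewrite qE -mulrA.
  rewrite RintegralZl//; last first.
    apply: (@integrable_compact_line (fun y => val psi (x, y)) _ M3).
    - exact: measurable_itv.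
    - exact/line/testFun_continuous.
    - by move=> y M3y; apply/psi0/nbox2.
  rewrite (@integral_halfline_derive (fun y => val (tpd false phi) (x, y))
    (fun y => val psi (x, y)) w.2 (Num.max M2 M3)
    (fun y => is_derive_line2 (tpd false phi) x y)).
  - by rewrite mulrN mulN1r.
  - exact/line/testFun_continuous.
  - by move=> y; rewrite gt_max => /andP[M2y _]; apply/dphi0/nbox2/gtn.
  - by move=> y; rewrite gt_max => /andP[_ M3y]; apply/psi0/nbox2/gtn.
have c1 := line' _ w.2 (testFun_continuous (tpd false phi)).
rewrite RintegralZl//; last first.
  apply: (@integrable_compact_line (fun x => val (tpd false phi) (x, w.2)) _ M2) => //.
  by move=> y M2y; apply/dphi0/nbox1.
rewrite (@integral_halfline_derive (fun x => val phi (x, w.2))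
  (fun x => val (tpd false phi) (x, w.2)) w.1 (Num.max M1 M2)
  (fun x => is_derive_line1 phi x w.2)) //.
- by rewrite mulN1r opprK -surjective_pairing.
- by move=> y; rewrite gt_max => /andP[M1y _]; apply/phi0/nbox1/gtn.
- by move=> y; rewrite gt_max => /andP[_ M2y]; apply/dphi0/nbox1/gtn.
Qed.

(** Fubini moves the derivatives of the test function onto the quadrant. *)
Lemma d12_smear_quadrant g : L1 g ->
  d12 (regular_distr (restrict2 (smear quadrant g))) = regular_distr g.
Proof.
move=> L1g; apply/funext => phi; rewrite d12E.
pose psi := tpd true (tpd false phi); rewrite -/psi.
pose K (p : mR2 * mR2) : R :=
  quadrant (eshift (p.1.1%:E, p.1.2%:E) p.2) * (val psi p.1 * g p.2).
have [q1 mq] := smearable_quadrant.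
have iK : (leb2 \x leb2)%E.-integrable setT (EFin \o K).
  apply: (@integrable_bounded_mul _ _ _ _ _ _ 1) => //; last first.
    by apply: (@integrable_tensor _ _ mR2 mR2); [exact: testFun_L1|exact: L1g].
  rewrite [X in measurable_fun _ X](_ : _ = fun p : mR2 * mR2 =>
      estep ((0 : R)%:E - (p.2.1 - p.1.1)%:E) * estep ((0 : R)%:E - (p.2.2 - p.1.2)%:E)).
    apply: measurable_funM; apply: (measurableT_comp (measurable_estep _));
    by apply: measurable_funB; do 2 apply: measurableT_comp => //.
  by apply/funext => p; rewrite /quadrant/eshift/= -!EFinB !sub0r !opprB.
transitivity (\int[leb2]_z \int[leb2]_w K (z, w)).
  apply: eq_Rintegral => -[x y] _.
  rewrite /restrict2 /= -RintegralZr//; last exact: smear_integrable smearable_quadrant L1g.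
  by apply: eq_Rintegral => w _; rewrite /K/= mulrAC mulrA mulrAC.
rewrite -(Rfubini1 iK) (Rfubini2 iK); apply: eq_Rintegral => w _.
rewrite -(integral_quadrant_testFun phi w) -/psi -RintegralZl//; last first.
  apply: (@integrable_bounded_mul _ _ _ leb2 _ _ 1) => //; last exact: testFun_L1.
  under eq_fun do rewrite /quadrant/= !estep_fin.
  by apply: measurable_funM; apply: measurableT_comp => //; apply: measurable_indic;
    exact: measurable_itv.
by apply: eq_Rintegral => z _; rewrite /K/= mulrA mulrC.
Qed.

End quadrant.

(** * A smooth step *)

Section smooth_step.
Context {R : realType}.
Implicit Types (f g : R -> R) (k n : nat) (a b x : R).

(** Derivatives are existentially quantified, so that closure properties are
    proved by exhibiting one derivative, without iterating [derive1]. *)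
Fixpoint Ck k f : Prop :=
  if k is k'.+1 then exists2 f', (forall x, is_derive x 1 f (f' x)) & Ck k' f'
  else continuous f.

Definition smooth1 f := forall k, Ck k f.

Lemma is_derive_continuous f f' : (forall x, is_derive x 1 f (f' x)) -> continuous f.
Proof.
move=> df x; apply: differentiable_continuous; apply/derivable1_diffP.
by have [] := df x.
Qed.

Lemma CkW k f : Ck k.+1 f -> Ck k f.
Proof.
elim: k f => [|k IH] f [f' df Cf']; first exact: is_derive_continuous df.
by exists f' => //; exact: IH.
Qed.

Lemma Ck_cst k a : Ck k (fun=> a).
Proof.
elim: k a => [|k IH] a; first exact: cst_continuous.
by exists (fun=> 0) => // x; exact: is_derive_cst.
Qed.

Lemma CkD k f g : Ck k f -> Ck k g -> Ck k (fun x => f x + g x).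
Proof.
elim: k f g => [|k IH] f g; first by move=> cf cg x; apply: cvgD; [exact: cf|exact: cg].
move=> [f' df Cf'] [g' dg Cg']; exists (fun x => f' x + g' x); last exact: IH.
by move=> x; exact: is_deriveD.
Qed.

Lemma CkM k f g : Ck k f -> Ck k g -> Ck k (fun x => f x * g x).
Proof.
elim: k f g => [|k IH] f g; first by move=> cf cg x; apply: cvgM; [exact: cf|exact: cg].
move=> Cf Cg; have [f' df Cf'] := Cf; have [g' dg Cg'] := Cg.
exists (fun x => f x * g' x + g x * f' x).
  by move=> x; exact: is_deriveM.
by apply: CkD; apply: IH => //; exact: CkW.
Qed.

Lemma CkV k f : (forall x, f x != 0) -> Ck k f -> Ck k (fun x => (f x)^-1).
Proof.
move=> f0; elim: k => [|k IH] Cf; first by move=> x; apply: cvgV => //; exact: Cf.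
have Ci := IH (CkW Cf); have [f' df Cf'] := Cf.
exists (fun x => -1 * ((f x)^-1 * (f x)^-1 * f' x)).
  move=> x; have H := (@is_deriveV _ f x (f' x) 1 (f0 x) (df x)). apply: (is_derive_eq H).
  by rewrite /= mulN1r -mulNr -invfM -expr2 [RHS]mulNr [LHS]mulNr.
by apply: CkM; [exact: Ck_cst|apply: CkM => //; exact: CkM].
Qed.

Lemma is_derive_affine a b x : is_derive x 1 (fun x : R => a * x + b) a.
Proof.
have H := is_deriveD (is_deriveZ a (is_derive_id x (1 : R))) (is_derive_cst b x (1 : R)).
by apply: (is_derive_eq H); rewrite addr0 [LHS]mulr1.
Qed.

Lemma Ck_affine k f a b : Ck k f -> Ck k (fun x => f (a * x + b)).
Proof.
elim: k f => [|k IH] f.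
  move=> cf x; apply: (cvg_comp (fun x => a * x + b) f); last exact: cf.
  exact: is_derive_continuous (is_derive_affine a b) x.
move=> [f' df Cf']; exists (fun x => f' (a * x + b) * a).
  by move=> x; apply: is_derive1_comp => //; exact: is_derive_affine.
by apply: CkM; [exact: IH|exact: Ck_cst].
Qed.

Lemma smooth1_derive f : smooth1 f ->
  (forall x, is_derive x 1 f (derive1 f x)) /\ smooth1 (derive1 f).
Proof.
have E f' : (forall x, is_derive x 1 f (f' x)) -> f' = derive1 f.
  by move=> df; apply/funext => x; rewrite derive1E; have [_ ->] := df x.
move=> sf; split.
  by have [f' df _] := sf 1; rewrite -(E f' df).
by move=> k; have [f' df] := sf k.+1; rewrite (E f' df).
Qed.

(** The functions [x^-n exp(-1/x)], extended by 0, form with their linear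
    combinations a class stable under differentiation, whence smoothness of
    the first of them at 0. *)
Definition flat n x : R := if 0 < x then (x^-1) ^+ n * expR (- x^-1) else 0.

Lemma flat_ge0 n x : 0 <= flat n x.
Proof.
rewrite /flat; case: ifPn => // x0.
by rewrite mulr_ge0 ?expR_ge0// exprn_ge0// invr_ge0 ltW.
Qed.

(** The exponential series at [u = 1/x] gives [u^(n+1) / (n+1)! <= exp u]. *)
Lemma flat_le n x : flat n x <= (n.+1)`!%:R * `|x|.
Proof.
rewrite /flat; case: ifPn => [x0|_]; last by rewrite mulr_ge0.
have u0 : 0 < x^-1 by rewrite invr_gt0.
rewrite expRN ler_pdivrMr ?expR_gt0// gtr0_norm//.
have fn0 : (n.+1)`!%:R != 0 :> R by rewrite pnatr_eq0 -lt0n fact_gt0.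
have -> : x^-1 ^+ n = (n.+1)`!%:R * x * (x^-1 ^+ n.+1 / (n.+1)`!%:R).
  by rewrite exprS [RHS]mulrA -(mulrA _ x) (mulrA x) mulfV ?gt_eqF// mul1r mulrAC mulfV// mul1r.
rewrite ler_wpM2l//; first by rewrite mulr_ge0// ltW.
by apply: le_trans (expR_ge1Dxn n (ltW u0)); rewrite lerDr.
Qed.

Lemma is_derive_flat n x :
  is_derive x 1 (flat n) (flat n.+2 x + (- n%:R) * flat n.+1 x).
Proof.
have [x0|x0|->] := ltgtP x 0.
- have -> : flat n.+2 x + - n%:R * flat n.+1 x = 0.
    by rewrite /flat !ltNge (ltW x0)/= mulr0 addr0.
  have H := is_derive_cst (0 : R) x (1 : R); apply: near_eq_is_derive H.
  have : nbhs x [set y | y < 0] by apply: open_nbhs_nbhs; split => //; exact: open_lt.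
  by apply: filterS => y /ltW y0; rewrite /flat ltNge y0.
- have nz : nbhs x [set y : R | 0 < y].
    by apply: open_nbhs_nbhs; split => //; exact: open_gt.
  have xn0 : x != 0 by rewrite gt_eqF.
  have dV : is_derive x 1 (fun y : R => y^-1) (- (x^-1 * x^-1)).
    have H := @is_deriveV _ id x 1 1 xn0 (is_derive_id _ _); apply: (is_derive_eq H).
    by rewrite /= -invfM -expr2 [LHS]mulr1.
  suff H : is_derive x 1 (fun y => (y^-1) ^+ n * expR (- y^-1))
      (x^-1 ^+ n.+2 * expR (- x^-1) - n%:R * (x^-1 ^+ n.+1 * expR (- x^-1))).
    rewrite /flat x0 mulNr; apply: near_eq_is_derive H.
    by apply: filterS nz => y /= ->.
  have dE : is_derive x 1 (fun y => expR (- y^-1)) (expR (- x^-1) * (x^-1 * x^-1)).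
    have H := @is_derive1_comp _ expR (fun y => - y^-1) x _ _
      (is_derive_expR _) (is_deriveN dV).
    by apply: (is_derive_eq H); rewrite opprK.
  have H := is_deriveM (is_deriveX n dV) dE.
  rewrite exprfctE in H.
  apply: (is_derive_eq H) => /=; set u := x^-1; set E := expR _.
  have pu : n%:R * u ^+ n.-1 * u * (u * E) = n%:R * u ^+ n * (u * E).
    by case: n {H} => [|m]; rewrite ?mul0r//= -(mulrA _ (u ^+ m)) -exprSr.
  rewrite !exprS.
  set p := n%:R * u ^+ n.-1 in pu *; set q := u ^+ n in pu *.
  by rewrite -![_ *: _]/(_ * _); lra.
(* at 0, the difference quotient of flat n is flat n.+1 *)
- have f0 : flat n 0 = 0 by rewrite /flat ltxx.
  have -> : flat n.+2 0 + - n%:R * flat n.+1 0 = 0.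
    by rewrite /flat ltxx mulr0 addr0.
  suff H : (fun h : R => h^-1 *: (flat n (h *: 1 + 0) - flat n 0)) @ 0^' --> (0 : R).
    split; first by apply/cvg_ex; exists 0.
    exact: cvg_lim H.
  apply/cvgr0Pnorm_le => e e0.
  have N0 : 0 < (n.+2)`!%:R :> R by rewrite ltr0n fact_gt0.
  have : \forall h \near (0 : R), `|h| <= e / (n.+2)`!%:R.
    apply/nbhs_ballP; exists (e / (n.+2)`!%:R); first exact: divr_gt0.
    by move=> h; rewrite /ball/= sub0r normrN => /ltW.
  move=> /nbhs_dnbhs; apply: filterS => h he.
  rewrite f0 subr0 addr0 [h *: 1]mulr1.
  have -> : h^-1 *: flat n h = flat n.+1 h.
    by rewrite /flat; case: ifPn => _; rewrite ?scaler0// exprS -mulrA.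
  rewrite ger0_norm ?flat_ge0// (le_trans (flat_le _ _))//.
  by rewrite mulrC -ler_pdivlMr.
Qed.

Lemma smooth1_flat n : smooth1 (flat n).
Proof.
move=> k; elim: k n => [|k IH] n; first exact: is_derive_continuous (is_derive_flat n).
exists (fun x => flat n.+2 x + - n%:R * flat n.+1 x); first exact: is_derive_flat.
by apply: CkD => //; apply: CkM => //; exact: Ck_cst.
Qed.

(** The classical smooth step, rising from 0 to 1 on the unit interval. *)
Definition step x : R := flat 0 x / (flat 0 x + flat 0 (1 - x)).

Lemma step_den x : flat 0 x + flat 0 (1 - x) != 0.
Proof.
have pos y : 0 < y -> 0 < flat 0 y by move=> y0; rewrite /flat y0 mul1r expR_gt0.
have [x0|x0] := ltP 0 x; first by rewrite gt_eqF// ltr_pwDl// ?pos// flat_ge0.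
by rewrite gt_eqF// ltr_wpDl// ?flat_ge0// pos// subr_gt0 (le_lt_trans x0).
Qed.

Lemma smooth1_step : smooth1 step.
Proof.
move=> k; have C1 : Ck k (fun x => flat 0 (1 - x)).
  have := Ck_affine (-1) 1 (@smooth1_flat 0 k).
  by under eq_fun do rewrite mulN1r addrC.
apply: CkM; first exact: smooth1_flat.
apply: CkV; first exact: step_den.
by apply: CkD => //; exact: smooth1_flat.
Qed.

Lemma step_le0 x : x <= 0 -> step x = 0.
Proof. by move=> x0; rewrite /step {1}/flat ltNge x0 mul0r. Qed.

Lemma step_ge1 x : 1 <= x -> step x = 1.
Proof.
move=> x1; have := step_den x; rewrite /step.
have -> : flat 0 (1 - x) = 0 by rewrite /flat ltNge subr_le0 x1.
by rewrite addr0 => /divff.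
Qed.

Definition bump : R -> R := derive1 step.

Lemma smooth1_bump : smooth1 bump.
Proof. exact: (smooth1_derive smooth1_step).2. Qed.

Lemma is_derive_step x : is_derive x 1 step (bump x).
Proof. exact: (smooth1_derive smooth1_step).1. Qed.

Lemma bump_lt0 x : x < 0 -> bump x = 0.
Proof.
move=> x0; rewrite /bump derive1E (@near_eq_derive _ _ _ step (cst 0)) ?derive_cst//.
have : nbhs x [set y | y < 0] by apply: open_nbhs_nbhs; split => //; exact: open_lt.
by apply: filterS => y /ltW /step_le0.
Qed.

Lemma bump_gt1 x : 1 < x -> bump x = 0.
Proof.
move=> x1; rewrite /bump derive1E (@near_eq_derive _ _ _ step (cst 1)) ?derive_cst//.
have : nbhs x [set y : R | 1 < y] by apply: open_nbhs_nbhs; split => //; exact: open_gt.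
by apply: filterS => y /ltW /step_ge1.
Qed.

Lemma bump_out x : 1 < `|x| -> bump x = 0.
Proof.
have [x0|x0 x1] := ltP x 0; first by rewrite bump_lt0.
by apply: bump_gt1; rewrite -(ger0_norm x0).
Qed.

End smooth_step.

(** * Uniqueness of primitives *)

Section uniqueness.
Context {R : realType}.
Local Notation mR := (measurableTypeR R).
Local Notation mR2 := (measurableTypeR R * measurableTypeR R)%type.
Local Notation mu := (@lebesgue_measure R).
Local Notation leb2 := (@leb2 R).
Implicit Types (F : \bar R * \bar R -> R) (r : R) (g : R * R -> R) (p q : R -> R) (a c x : R).

Definition scale2 (r : R) (w : R * R) : R * R := (r * w.1, r * w.2).

Lemma measurable_scaled F (z : \bar R * \bar R) r : continuous F ->
  measurable_fun [set: mR2] (fun w => F (eshift z (scale2 r w))).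
Proof.
move=> cF; apply: continuous_measurable_fun2 => w.
apply: (cvg_comp (fun w => eshift z (scale2 r w)) F); last exact: cF.
apply: cvg_eshift; first exact: cvg_cst.
apply: (@cvg_pair _ _ _ _ (nbhs (r * w.1)) (nbhs (r * w.2))).
  by apply: cvgMr; exact: cvg_fst.
by apply: cvgMr; exact: cvg_snd.
Qed.

(** Concentration at the origin: letting the base points vary makes the
    convergence uniform without any measurable modulus of continuity. *)
Lemma cvg_concentrate F g (u : nat -> \bar R * \bar R) (r : nat -> R) :
  continuous F -> L1 g -> r @ \oo --> (0 : R) ->
  \int[leb2]_w ((F (eshift (u n) (scale2 (r n) w)) - F (u n)) * g w)
    @[n --> \oo] --> (0 : R).
Proof.
move=> cF L1g r0; have [C C0 FC] := continuous_ereal2_bounded cF.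
have mg := L1_measurable L1g.
have -> : (0 : R) = \int[leb2]_w cst 0 w by rewrite Rintegral_cst// mul0r.
apply: (@Rintegral_dominated_cvg _ _ _ leb2 _ _ (fun w => (C + C) * `|g w|)).
- move=> n; apply: measurable_funM => //; apply: measurable_funB => //.
  exact: measurable_scaled.
- exact: measurable_cst.
- by apply: L1_scale; exact: L1_norm.
- move=> n w; rewrite normrM ler_wpM2r// (le_trans (ler_normB _ _))//.
  by rewrite lerD.
apply: aeW => w; rewrite -[cst 0 w](mul0r (g w)); apply: cvgMl.
apply/cvgr0Pnorm_lt => e e0.
have rx x : r n * x @[n --> \oo] --> (0 : R).
  by rewrite -[X in _ --> X](mul0r x); exact: cvgMl.
have rw : (fun n => scale2 (r n) w) @ \oo --> (0 : R * R).
  by apply: (@cvg_pair _ _ _ _ (nbhs (0 : R)) (nbhs (0 : R))); exact: rx.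
have := rw _ (continuous_eshift_uniform cF e0).
by apply: (@filterS _ \oo) => n /= H; exact: H.
Qed.

Definition tensor p q : R * R -> R := fun z => p z.1 * q z.2.

Lemma is_derive_tensor b p q z : smooth1 p -> smooth1 q ->
  is_derive z (axis b) (tensor p q)
    ((if b then tensor p (derive1 q) else tensor (derive1 p) q) z).
Proof.
move=> sp sq.
have quot f x : smooth1 f ->
    (fun h : R => h^-1 *: (f (h *: 1 + x) - f x)) @ 0^' --> derive1 f x.
  by move=> sf; have [d _] := (smooth1_derive sf).1 x; rewrite derive1E; exact: d.
suff H : (fun h : R => h^-1 *: (tensor p q (h *: axis b + z) - tensor p q z)) @ 0^'
    --> (if b then tensor p (derive1 q) else tensor (derive1 p) q) z.
  by split; [apply/cvg_ex; eexists; exact: H|exact: cvg_lim H].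
case: z => x y; case: b; rewrite /tensor/=.
  have -> : (fun h : R => h^-1 *: (p (h *: 0 + x) * q (h *: 1 + y) - p x * q y)) =
      fun h => p x * (h^-1 *: (q (h *: 1 + y) - q y)).
    by apply/funext => h; rewrite scaler0 add0r -mulrBr -scalerAr.
  by apply: cvgMr; exact: quot.
have -> : (fun h : R => h^-1 *: (p (h *: 1 + x) * q (h *: 0 + y) - p x * q y)) =
    fun h => (h^-1 *: (p (h *: 1 + x) - p x)) * q y.
  by apply/funext => h; rewrite scaler0 add0r -mulrBl -scalerAl.
by apply: cvgMl; exact: quot.
Qed.

Lemma pd_tensor b p q : smooth1 p -> smooth1 q ->
  pd b (tensor p q) = if b then tensor p (derive1 q) else tensor (derive1 p) q.
Proof.
by move=> sp sq; apply/funext => z; have [_ <-] := is_derive_tensor b z sp sq.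
Qed.

Lemma pds_tensor w p q : smooth1 p -> smooth1 q ->
  exists p' q', [/\ smooth1 p', smooth1 q' & pds w (tensor p q) = tensor p' q'].
Proof.
move=> sp sq; elim: w => [|b w [p' [q' [sp' sq' E]]]]; first by exists p, q.
rewrite /= E pd_tensor//; case: b.
  by exists p', (derive1 q'); split => //; exact: (smooth1_derive sq').2.
by exists (derive1 p'), q'; split => //; exact: (smooth1_derive sp').2.
Qed.

Lemma smooth_tensor p q : smooth1 p -> smooth1 q -> smooth (tensor p q).
Proof.
move=> sp sq w; have [p' [q' [sp' sq' ->]]] := pds_tensor w sp sq; split.
  move=> z; apply: cvgM.
    apply: (cvg_comp _ p'); first exact: cvg_fst.
    exact: (sp' 0).
  apply: (cvg_comp _ q'); first exact: cvg_snd.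
  exact: (sq' 0).
by move=> b z; have [] := is_derive_tensor b z sp' sq'.
Qed.

Lemma tensor_test_fun p q M : smooth1 p -> smooth1 q ->
  (forall x, M < `|x| -> p x = 0) -> (forall x, M < `|x| -> q x = 0) ->
  tensor p q \in test_fun.
Proof.
move=> sp sq p0 q0; rewrite unfold_in; apply/asboolP.
split; first exact: smooth_tensor.
have cbox : compact (box M).
  by rewrite box_itv; apply: compact_setX; exact: segment_compact.
apply: (@support_subset_compact _ _ (box M)) => //.
  by apply: compact_closed cbox; exact: norm_hausdorff.
move=> z nz; rewrite /tensor; have [z1|z1] := leP `|z.1| M; last by rewrite p0// mul0r.
  have [z2|z2] := leP `|z.2| M; last by rewrite q0// mulr0.
  by case: nz.
Qed.

(** Rescaled steps and bumps, located in [[a, a + 1/c]]. *)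
Definition ramp c a x : R := step (c * x + - (c * a)).
Definition dramp c a x : R := bump (c * x + - (c * a)) * c.

Lemma is_derive_ramp c a x : is_derive x 1 (ramp c a) (dramp c a x).
Proof.
exact: (@is_derive1_comp _ step (fun x => c * x + - (c * a)) x _ _
  (is_derive_step _) (is_derive_affine _ _ _)).
Qed.

Lemma smooth1_ramp c a : smooth1 (ramp c a).
Proof. by move=> k; apply: Ck_affine; exact: smooth1_step. Qed.

Lemma smooth1_dramp c a : smooth1 (dramp c a).
Proof.
by move=> k; apply: CkM; [apply: Ck_affine; exact: smooth1_bump|exact: Ck_cst].
Qed.

Lemma bump_affine_out c a x : 0 < c -> `|a| + c^-1 < `|x| -> 1 < `|c * x + - (c * a)|.
Proof.
move=> c0 ax; rewrite -mulrBr normrM gtr0_norm// -ltr_pdivrMl// mulr1.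
by rewrite (lt_le_trans _ (lerB_dist _ _))// ltrBrDl.
Qed.

Lemma integral_bump : \int[mu]_x bump x = 1.
Proof.
have -> : bump = fun x => \1_(`[0, +oo[%classic : set R) x * bump x.
  apply/funext => x; rewrite indicE; have [x0|x0] := ltP x 0.
    by rewrite bump_lt0// mulr0.
  by rewrite mem_set ?mul1r//= in_itv/= x0.
have d x : is_derive x 1 (fun y => step y - 1) (bump x).
  have H := is_deriveB (is_derive_step x) (is_derive_cst (1 : R) x (1 : R)).
  by apply: (is_derive_eq H); rewrite subr0.
rewrite (@integral_halfline_derive _ (fun x => step x - 1) bump 0 1 d).
- by rewrite step_le0// sub0r opprK.
- exact: (smooth1_bump 0).
- by move=> y /ltW /step_ge1 ->; rewrite subrr.
- exact: bump_gt1.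
Qed.

Lemma integrable_compact_support (k : R -> R) (M : R) : continuous k ->
  (forall y, M < `|y| -> k y = 0) -> mu.-integrable setT (EFin \o k).
Proof.
move=> ck k0; have := @integrable_compact_line _ k setT M measurableT ck k0.
by under [X in _.-integrable _ (EFin \o X)]eq_fun do rewrite indicT mul1r.
Qed.

Lemma L1_bump2 : L1 (tensor bump bump : R * R -> R).
Proof.
have ib := @integrable_compact_support bump 1 (smooth1_bump 0) bump_out.
exact: (@integrable_tensor _ _ mR mR).
Qed.

Lemma integral_bump2 : \int[leb2]_z tensor bump bump z = 1.
Proof.
rewrite [LHS](@Rfubini1 _ _ mR mR R mu mu _ L1_bump2) /tensor/=.
have ib := @integrable_compact_support bump 1 (smooth1_bump 0) bump_out.
under eq_Rintegral do rewrite RintegralZl// integral_bump mulr1.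
exact: integral_bump.
Qed.

(** The average of [F] against a bump of width [1/c] at [(a, b)]; it is itself
    a mixed derivative of [F] in the sense of distributions. *)
Definition mollified F c a (b : R) : R :=
  \int[leb2]_z (F (z.1%:E, z.2%:E) * tensor (dramp c a) (dramp c b) z).

Lemma mollified_L1 F c a (b : R) : 0 < c -> continuous F ->
  L1 (fun z => F (z.1%:E, z.2%:E) * tensor (dramp c a) (dramp c b) z).
Proof.
move=> c0 cF; have [C C0 FC] := continuous_ereal2_bounded cF.
have id a' : mu.-integrable setT (EFin \o dramp c a').
  apply: (@integrable_compact_support _ (`|a'| + c^-1)).
    exact: (smooth1_dramp c a' 0).
  by move=> y ay; rewrite /dramp bump_out ?mul0r//; exact: bump_affine_out.
apply: (@integrable_bounded_mul _ _ _ leb2 _ _ C) => //.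
  apply: continuous_measurable_fun2 => z.
  apply: (cvg_comp (fun z : R * R => (z.1%:E, z.2%:E)) F); last exact: cF.
  apply: (@cvg_pair _ _ _ _ (nbhs z.1%:E) (nbhs z.2%:E)).
    by apply: cvg_EFin; [exact: nearW|exact: cvg_fst].
  by apply: cvg_EFin; [exact: nearW|exact: cvg_snd].
exact: (@integrable_tensor _ _ mR mR).
Qed.

Lemma mollifiedE F c a (b : R) : 0 < c -> continuous F ->
  mollified F c a b = \int[leb2]_w
    (F (eshift (a%:E, b%:E) (scale2 (- c^-1) w)) * tensor bump bump w).
Proof.
move=> c0 cF; have [C C0 FC] := continuous_ereal2_bounded cF.
pose h w := F (eshift (a%:E, b%:E) (scale2 (- c^-1) w)) * tensor bump bump w.
have L1h : L1 h.
  apply: (@integrable_bounded_mul _ _ _ leb2 _ _ C) => //; last exact: L1_bump2.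
  exact: measurable_scaled.
have [L1ha E] := L1_affine (- (c * a), - (c * b)) c0 L1h.
rewrite -[RHS](mulKf (x := c^-2)) ?invr_eq0 ?expf_neq0 ?gt_eqF// -E invrK.
rewrite -RintegralZl//; apply: eq_Rintegral => -[x y] _.
rewrite /h /tensor /dramp /scale2 /affine2 /eshift/= -!EFinB.
have inv t s : s - - c^-1 * (c * t + - (c * s)) = t.
  by rewrite mulNr opprK mulrBr !mulKf ?gt_eqF// addrC subrK.
by rewrite !inv [X in _ * X = _]mulrACA -expr2 [LHS]mulrA [LHS]mulrC.
Qed.

Lemma mollified_cvg F a (b : R) : continuous F ->
  mollified F n.+1%:R a b @[n --> \oo] --> F (a%:E, b%:E).
Proof.
move=> cF.
have r0 : (fun n : nat => - n.+1%:R^-1) @ \oo --> (0 : R).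
  by rewrite -oppr0; apply: cvgN; exact: cvg_harmonic.
have := cvg_concentrate (fun=> (a%:E, b%:E)) cF L1_bump2 r0.
have -> : (fun n => \int[leb2]_w ((F (eshift (a%:E, b%:E) (scale2 (- n.+1%:R^-1) w)) -
    F (a%:E, b%:E)) * tensor bump bump w)) =
    fun n => mollified F n.+1%:R a b - F (a%:E, b%:E).
  apply/funext => n; rewrite mollifiedE//.
  have [C C0 FC] := continuous_ereal2_bounded cF.
  under eq_Rintegral do rewrite mulrBl.
  rewrite RintegralB//; last 2 first.
  - apply: (@integrable_bounded_mul _ _ _ leb2 _ _ C) => //; last exact: L1_bump2.
    exact: measurable_scaled.
  - exact: L1_scale L1_bump2.
  by rewrite RintegralZl ?integral_bump2 ?mulr1//; exact: L1_bump2.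
by move/subr_cvg0.
Qed.

Lemma ramp_out c a x : 0 < c -> `|a| + c^-1 < `|x| ->
  ramp c a x = if 0 < x then 1 else 0.
Proof.
move=> c0 ax; rewrite /ramp -mulrBr.
have ac : `|a| < `|x| - c^-1 by rewrite ltrBrDr.
have := ltr_normlW ac; have := ltrNnormlW ac.
case: ifPn => [x0|]; [rewrite (gtr0_norm x0)|rewrite -leNgt => x0; rewrite (ler0_norm x0)].
  by move=> _ ax'; rewrite step_ge1// -ler_pdivrMl// mulr1 lerBrDl ltW// -ltrBrDr.
have ci : 0 < c^-1 by rewrite invr_gt0.
by move=> xa _; rewrite step_le0// pmulr_rle0// subr_le0 ltW//; lra.
Qed.

(** A single ramp is not compactly supported, a difference of two is. *)
Definition window c a a' x : R := ramp c a x + -1 * ramp c a' x.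

Lemma window_out c a a' x : 0 < c -> Num.max `|a| `|a'| + c^-1 < `|x| ->
  window c a a' x = 0.
Proof.
move=> c0; rewrite -ltrBrDr gt_max !ltrBrDr => /andP[ax a'x].
by rewrite /window !ramp_out// mulN1r subrr.
Qed.

Lemma smooth1_window c a a' : smooth1 (window c a a').
Proof.
move=> k; apply: CkD; first exact: smooth1_ramp.
by apply: CkM; [exact: Ck_cst|exact: smooth1_ramp].
Qed.

Lemma derive1_window c a a' :
  derive1 (window c a a') = fun x => dramp c a x - dramp c a' x.
Proof.
apply/funext => x; rewrite derive1E.
have H := is_deriveD (is_derive_ramp c a x)
  (is_deriveM (is_derive_cst (-1 : R) x (1 : R)) (is_derive_ramp c a' x)).
have [_ E] := H; rewrite -[LHS]/('D_1 (ramp c a + cst (-1) * ramp c a') x) E.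
by rewrite scaler0 addr0 scaleN1r.
Qed.

(** Testing against products of two windows only sees the increments of [F]
    over rectangles. *)
Lemma mollified_increment F c a a' (b b' : R) : 0 < c -> continuous F ->
  d12 (regular_distr (restrict2 F)) = 0 ->
  mollified F c a b - mollified F c a' b -
  (mollified F c a b' - mollified F c a' b') = 0.
Proof.
move=> c0 cF dF0.
pose M := Num.max (Num.max `|a| `|a'| + c^-1) (Num.max `|b| `|b'| + c^-1).
have tt : tensor (window c a a') (window c b b') \in test_fun.
  apply: (@tensor_test_fun _ _ M); try exact: smooth1_window.
    by move=> x; rewrite gt_max => /andP[+ _]; exact: window_out.
  by move=> x; rewrite gt_max => /andP[_ +]; exact: window_out.
pose phi : testFun R := exist (fun f => f \in test_fun) _ tt.
transitivity (regular_distr (restrict2 F) (tpd true (tpd false phi))); last first.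
  by rewrite -d12E dF0.
have L1m a1 b1 := mollified_L1 a1 b1 c0 cF.
have intB (f1 f2 : R * R -> R) : L1 f1 -> L1 f2 ->
    \int[leb2]_z f1 z - \int[leb2]_z f2 z = \int[leb2]_z (f1 z - f2 z).
  by move=> L1f1 L1f2; rewrite RintegralB.
have E b1 : mollified F c a b1 - mollified F c a' b1 = \int[leb2]_z
    (F (z.1%:E, z.2%:E) * tensor (dramp c a) (dramp c b1) z -
     F (z.1%:E, z.2%:E) * tensor (dramp c a') (dramp c b1) z).
  exact: intB _ _ (L1m a b1) (L1m a' b1).
apply: (etrans (congr2 (fun s t => s - t) (E b) (E b'))).
have L1B a1 a2 b1 : L1 (fun z =>
    F (z.1%:E, z.2%:E) * tensor (dramp c a1) (dramp c b1) z -
    F (z.1%:E, z.2%:E) * tensor (dramp c a2) (dramp c b1) z).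
  have := L1D (L1m a1 b1) (L1_scale (-1) (L1m a2 b1)).
  by under eq_fun do rewrite mulN1r.
apply: (etrans (intB _ _ (L1B a a' b) (L1B a a' b'))).
apply: eq_Rintegral => z _; rewrite /restrict2/=.
rewrite !pd_tensor; try exact: smooth1_window; last first.
  exact: (smooth1_derive (smooth1_window c a a')).2.
rewrite !derive1_window /tensor.
have alg (u s s' t t' : R) : u * (s * t) - u * (s' * t) - (u * (s * t') - u * (s' * t')) =
    u * ((s - s') * (t - t')) by rewrite -!mulrBr -!mulrBl -mulrBr.
exact: alg.
Qed.

Lemma cvg_cst_eq (u : nat -> R) (k l : R) : (forall n, u n = k) ->
  u @ \oo --> l -> l = k.
Proof.
move=> uk ul; rewrite -(cvg_lim (@Rhausdorff R) ul).
by rewrite (_ : u = fun=> k) ?lim_cst//; apply/funext.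
Qed.

(** Shrinking the bumps, [F] itself has no increments over rectangles; two sides
    of a rectangle are sent to minus infinity, where [F] vanishes. *)
Lemma primitive_unique0 F : Bc F -> d12 (regular_distr (restrict2 F)) = 0 ->
  F = fun=> 0.
Proof.
move=> [cF F0] dF0.
have inc a a' (b b' : R) : F (a%:E, b%:E) - F (a'%:E, b%:E) -
    (F (a%:E, b'%:E) - F (a'%:E, b'%:E)) = 0.
  have c1 := @mollified_cvg F a b cF; have c2 := @mollified_cvg F a' b cF.
  have c3 := @mollified_cvg F a b' cF; have c4 := @mollified_cvg F a' b' cF.
  have c := cvgB (cvgB c1 c2) (cvgB c3 c4).
  by apply: cvg_cst_eq (c _ _ _) => n; exact: mollified_increment.
have cvgF (u v : nat -> \bar R) (x y : \bar R) : u @ \oo --> x -> v @ \oo --> y ->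
    F (u n, v n) @[n --> \oo] --> F (x, y).
  move=> ux vy; apply: (cvg_comp (fun n => (u n, v n)) F); last exact: cF.
  exact: (@cvg_pair _ _ _ _ (nbhs x) (nbhs y)).
have [u uNy] := ereal_real_seq (-oo%E : \bar R).
have F0fin (a b : R) : F (a%:E, b%:E) = 0.
  have ca := cvgF _ _ _ _ (cvg_cst a%:E) uNy.
  have cb := cvgF _ _ _ _ uNy (cvg_cst b%:E).
  have cab := cvgF _ _ _ _ uNy uNy.
  have := cvgD (cb _) (cvgB (ca _) cab).
  rewrite (F0 _).1 (F0 _).2 (F0 _).1 subr0 addr0 => c.
   apply/esym; apply: cvg_cst_eq (c _ _ _ _) => n /=.
  have /subr0_eq E := inc a (u n) b (u n).
  rewrite -[LHS]/(F ((u n)%:E, b%:E) + (F (a%:E, (u n)%:E) - F ((u n)%:E, (u n)%:E))).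
  by rewrite -E addrC subrK.
apply/funext => -[x y].
have [ux uxx] := ereal_real_seq x; have [uy uyy] := ereal_real_seq y.
by apply: cvg_cst_eq (cvgF _ _ _ _ uxx uyy) => n; exact: F0fin.
Qed.

End uniqueness.

(** * Density of integrable functions *)

Section density.
Context {R : realType}.
Local Notation mR := (measurableTypeR R).
Local Notation mR2 := (measurableTypeR R * measurableTypeR R)%type.
Local Notation mu := (@lebesgue_measure R).
Local Notation leb2 := (@leb2 R).
Implicit Types (F : \bar R * \bar R -> R) (g : R * R -> R) (k : R -> R) (x y : \bar R).

Definition prim1 k x : R := \int[mu]_s (estep (x - s%:E) * k s).

Lemma integrable_estep k x : mu.-integrable setT (EFin \o k) ->
  mu.-integrable setT (EFin \o (fun s => estep (x - s%:E) * k s)).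
Proof.
apply: (@integrable_bounded_mul _ mR _ mu _ k 1) => [|s]; last exact: estep_le1.
exact: measurable_estep.
Qed.

Lemma prim1B k k' x : mu.-integrable setT (EFin \o k) ->
  mu.-integrable setT (EFin \o k') ->
  prim1 (fun s => k s - k' s) x = prim1 k x - prim1 k' x.
Proof.
move=> ik ik'; rewrite /prim1.
under eq_Rintegral do rewrite mulrBr.
by rewrite RintegralB//; exact: integrable_estep.
Qed.

Lemma smear_tensor k k' x y : mu.-integrable setT (EFin \o k) ->
  mu.-integrable setT (EFin \o k') ->
  smear quadrant (tensor k k') (x, y) = prim1 k x * prim1 k' y.
Proof.
move=> ik ik'.
have L1k : L1 (tensor k k') by exact: (@integrable_tensor _ _ mR mR).
have L1q := smear_integrable (x, y) smearable_quadrant L1k.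
rewrite /smear [LHS](@Rfubini1 _ _ mR mR R mu mu _ L1q)/=.
transitivity (\int[mu]_s (estep (x - s%:E) * k s * prim1 k' y)).
  apply: eq_Rintegral => s _; rewrite /prim1 -RintegralZl//; last exact: integrable_estep.
  by apply: eq_Rintegral => t _; rewrite /quadrant /tensor/= mulrACA.
by rewrite RintegralZr//; exact: integrable_estep.
Qed.

Lemma smear_sum C Phi (I : Type) (s : seq I) (f : I -> R * R -> R) z :
  smearable C Phi -> (forall i, L1 (f i)) ->
  smear Phi (fun w => \sum_(i <- s) f i w) z = \sum_(i <- s) smear Phi (f i) z.
Proof.
move=> sPhi L1f; elim: s => [|i s IH]; rewrite /smear.
  under eq_Rintegral do rewrite big_nil mulr0.
  by rewrite big_nil Rintegral_cst// mul0r.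
under eq_Rintegral do rewrite big_cons mulrDr.
rewrite big_cons -[X in _ = _ + X]IH RintegralD//.
- exact: smear_integrable sPhi (L1f i).
- by apply: (smear_integrable z sPhi); exact: L1_sum.
Qed.

Lemma smear_scale C Phi a g z : smearable C Phi -> L1 g ->
  smear Phi (fun w => a * g w) z = a * smear Phi g z.
Proof.
move=> sPhi L1g; rewrite /smear -RintegralZl//; last exact: smear_integrable sPhi L1g.
by apply: eq_Rintegral => w _; rewrite mulrCA.
Qed.

(** The half-open interval makes the primitive vanish up to [a] without any
    null set to discard. *)
Definition unif (a b : R) (s : R) : R := (b - a)^-1 * \1_(`]a, b]%classic : set R) s.

Lemma integrable_unif a b : mu.-integrable setT (EFin \o unif a b).
Proof.
have := integrableZl measurableT (b - a)^-1 (integrable_indic_itv a b false false).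
by apply: eq_integrable.
Qed.

Lemma unif_ge0 a b s : a < b -> 0 <= unif a b s.
Proof. by move=> ab; rewrite mulr_ge0// invr_ge0 subr_ge0 ltW. Qed.

Lemma integral_unif a b : a < b -> \int[mu]_s unif a b s = 1.
Proof.
move=> ab; rewrite /unif RintegralZl//; last exact: integrable_indic_itv.
rewrite /Rintegral integral_indic// setIT.
have E : mu `]a, b]%classic = (b - a)%:E.
  by have -> := @lebesgue_measure_itv R `]a, b]; rewrite /= lte_fin ab -EFinB.
rewrite -[X in _ * fine X]/(mu `]a, b]%classic) E /=.
by rewrite mulVf// subr_eq0 gt_eqF.
Qed.

Lemma prim1_unif_ge0 a b x : a < b -> 0 <= prim1 (unif a b) x.
Proof.
move=> ab; apply: Rintegral_ge0 => s _; by rewrite mulr_ge0 ?unif_ge0.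
Qed.

Lemma prim1_unif_le1 a b x : a < b -> prim1 (unif a b) x <= 1.
Proof.
move=> ab; rewrite -(integral_unif ab); apply: le_Rintegral => //.
- exact: integrable_estep (integrable_unif a b).
- exact: integrable_unif.
- move=> s _; rewrite ler_piMl ?unif_ge0//.
  by rewrite /estep; case: (_ <= _)%E.
Qed.

Lemma prim1_unif_eq0 a b x : (x <= a%:E)%E -> prim1 (unif a b) x = 0.
Proof.
move=> xa; rewrite /prim1; transitivity (\int[mu]_s cst 0 s).
  apply: eq_Rintegral => s _; rewrite /unif indicE.
  have [sa|sa] := leP s a; first by rewrite memNset ?mulr0//= in_itv/= ltNge sa.
  rewrite /estep sube_ge0//; rewrite leNgt (le_lt_trans xa) ?lte_fin// mul0r//.
by rewrite Rintegral_cst// mul0r.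
Qed.

Lemma prim1_unif_eq1 a b x : a < b -> (b%:E <= x)%E -> prim1 (unif a b) x = 1.
Proof.
move=> ab bx; rewrite -(integral_unif ab); apply: eq_Rintegral => s _.
have [sb|sb] := leP s b; last first.
  by rewrite /unif indicE memNset ?mulr0//= in_itv/= [s <= b]leNgt sb andbF.
by rewrite /estep sube_ge0// (le_trans _ bx) ?lee_fin// mul1r.
Qed.

(** Two applications of the partition of unity express both [F (x, y)] and its
    interpolation as averages with the same weights. *)
Lemma partition_approx F (n : nat) (p : 'I_n -> \bar R) (w : 'I_n -> \bar R -> R) (e : R) :
  (forall i x, 0 <= w i x) -> (forall x, \sum_i w i x = 1) ->
  (forall i j x y, w i x != 0 -> w j y != 0 -> `|F (x, y) - F (p i, p j)| <= e) ->
  forall x y, `|F (x, y) - \sum_ij F (p ij.1, p ij.2) * (w ij.1 x * w ij.2 y)| <= e.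
Proof.
move=> w0 w1 Fp x y.
have ww1 : \sum_(ij : 'I_n * 'I_n) w ij.1 x * w ij.2 y = 1.
  rewrite -(pair_bigA _ (fun i j => w i x * w j y))/=.
  by under eq_bigr do rewrite -mulr_sumr w1 mulr1; exact: w1.
rewrite -[F (x, y)]mulr1 -ww1 mulr_sumr -sumrB (le_trans (ler_norm_sum _ _ _))//.
rewrite -[e]mulr1 -ww1 mulr_sumr; apply: ler_sum => -[i j] _ /=.
rewrite -mulrBl normrM [X in _ * X <= _]ger0_norm ?mulr_ge0//.
have [->|wi] := eqVneq (w i x) 0; first by rewrite mul0r !mulr0.
have [->|wj] := eqVneq (w j y) 0; first by rewrite mulr0 !mulr0.
by rewrite ler_wpM2r ?mulr_ge0// Fp.
Qed.

Lemma prim10 x : prim1 (fun=> 0) x = 0.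
Proof.
by rewrite /prim1; under eq_Rintegral do rewrite mulr0; rewrite Rintegral_cst// mul0r.
Qed.

(** The nodes are equally spaced in the coordinate [contract]. The [i]-th rise
    takes place between the nodes [i - 1] and [i], in the middle part of the
    interval, so that it ends before the next one starts and its end points
    are real even next to infinity. Consecutive rises differ near one node. *)
Section partition_of_unity.
Variable n : nat.
Let h : R := n.+1%:R^-1.
Let t (i : nat) : R := -1 + 2 * i%:R * h.
Let a (i : nat) : R := fine (expand (t i + h / 2)).
Let b (i : nat) : R := fine (expand (t i + h)).

Let h_gt0 : 0 < h. Proof. by rewrite invr_gt0. Qed.

Let t_lt1 (i : nat) : (i < n.+1)%N -> t i + 2 * h <= 1.
Proof.
move=> i_n; have : i.+1%:R * h <= 1 by rewrite ler_pdivrMr// mul1r ler_nat.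
by rewrite /t -[i.+1%:R]natr1; lra.
Qed.

Let t_ge (i : nat) : -1 <= t i.
Proof.
have : 0 <= i%:R * h by rewrite mulr_ge0// ltW.
by rewrite /t; lra.
Qed.

Let aE (i : nat) : (i < n.+1)%N -> (a i)%:E = expand (t i + h / 2).
Proof.
move=> i_n; rewrite fine_expand// ltr_norml.
by have := t_lt1 i_n; have := t_ge i; have := h_gt0; lra.
Qed.

Let bE (i : nat) : (i < n.+1)%N -> (b i)%:E = expand (t i + h).
Proof.
move=> i_n; rewrite fine_expand// ltr_norml.
by have := t_lt1 i_n; have := t_ge i; have := h_gt0; lra.
Qed.

Let contract_a (i : nat) : (i < n.+1)%N -> contract (a i)%:E = t i + h / 2.
Proof.
move=> i_n; rewrite aE// expandK// inE ler_norml.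
by have := t_lt1 i_n; have := t_ge i; have := h_gt0; lra.
Qed.

Let contract_b (i : nat) : (i < n.+1)%N -> contract (b i)%:E = t i + h.
Proof.
move=> i_n; rewrite bE// expandK// inE ler_norml.
by have := t_lt1 i_n; have := t_ge i; have := h_gt0; lra.
Qed.

Let a_lt_b (i : nat) : (i < n.+1)%N -> a i < b i.
Proof.
move=> i_n; rewrite -lte_fin -lt_contract contract_a// contract_b//.
by have := h_gt0; lra.
Qed.

Let b_lt_a (i : nat) : (i.+1 < n.+1)%N -> b i < a i.+1.
Proof.
move=> i_n; rewrite -lte_fin -lt_contract contract_b ?contract_a//; last exact: ltnW.
by rewrite /t -[i.+1%:R]natr1; have := h_gt0; lra.
Qed.

Definition density (i : nat) : R -> R :=
  if (0 < i <= n.+1)%N then unif (a i.-1) (b i.-1) else fun=> 0.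

Definition rise (i : nat) x : R := if i == 0 then 1 else prim1 (density i) x.

Definition node (i : nat) : \bar R := expand (t i).

Definition weight (i : nat) x : R := rise i x - rise i.+1 x.

Lemma integrable_density i : mu.-integrable setT (EFin \o density i).
Proof.
rewrite /density; case: ifPn => _; first exact: integrable_unif.
exact: integrable0.
Qed.

Lemma weight_density i x : (0 < i)%N ->
  weight i x = prim1 (fun s => density i s - density i.+1 s) x.
Proof.
case: i => // i _; rewrite prim1B//; exact: integrable_density.
Qed.

Let rise0 x : rise 0 x = 1. Proof. by []. Qed.
Let rise_last x : rise n.+2 x = 0.
Proof. by rewrite /rise/= /density/= ltnn prim10. Qed.
Let riseS (i : nat) x : (i < n.+1)%N -> rise i.+1 x = prim1 (unif (a i) (b i)) x.
Proof. by move=> i_n; rewrite /rise/= /density/= i_n. Qed.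

Let rise_ge0 (i : nat) x : 0 <= rise i x.
Proof.
rewrite /rise; case: ifPn => // i0.
rewrite /density; case: ifPn => [/andP[_ i_n]|]; last by rewrite prim10.
by apply/prim1_unif_ge0/a_lt_b; case: i i0 i_n.
Qed.

Let rise_le1 (i : nat) x : rise i x <= 1.
Proof.
rewrite /rise; case: ifPn => // i0.
rewrite /density; case: ifPn => [/andP[_ i_n]|]; last by rewrite prim10.
by apply/prim1_unif_le1/a_lt_b; case: i i0 i_n.
Qed.

Let rise_nonincreasing (i : nat) x : (i < n.+2)%N -> rise i.+1 x <= rise i x.
Proof.
case: i => [_|i i_n]; first by rewrite rise0 rise_le1.
move: i_n; rewrite ltnS leq_eqVlt => /orP[/eqP[->]|i_n]; first by rewrite rise_last rise_ge0.
rewrite [leLHS]riseS//; have [xa|xa] := leP x (a i.+1)%:E.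
  by rewrite prim1_unif_eq0 ?rise_ge0.
rewrite [leRHS]riseS; last exact: ltnW.
rewrite [leRHS]prim1_unif_eq1 ?prim1_unif_le1 ?a_lt_b//; first exact: ltnW.
by rewrite (le_trans _ (ltW xa))// lee_fin ltW// b_lt_a.
Qed.

Lemma weight_ge0 (i : 'I_n.+2) x : 0 <= weight i x.
Proof. by rewrite subr_ge0 rise_nonincreasing. Qed.

Lemma sum_weight x : \sum_(i < n.+2) weight i x = 1.
Proof.
rewrite -(big_mkord xpredT (fun i => weight i x)).
rewrite (@telescope_sumr_eq _ 0 n.+2 (fun i => - rise i x))//.
  by rewrite rise_last rise0 oppr0 opprK add0r.
by move=> k _; rewrite /weight opprK addrC.
Qed.

Lemma weight_support (i : 'I_n.+2) x : weight i x != 0 ->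
  `|contract x - contract (node i)| < 2 * h.
Proof.
have tn : t n.+1 = 1 by rewrite /t -mulrA mulfV//; lra.
have hi : `|t i| <= 1.
  rewrite ler_norml t_ge/=; case: i => i /=; rewrite ltnS leq_eqVlt => /orP[/eqP ->|].
    by rewrite tn.
  by move=> /t_lt1; have := h_gt0; lra.
rewrite /node expandK ?inE// ltr_norml => wi; apply/andP; split.
  case: i hi wi => -[|i] /= i_n hi wi.
    have := contract_le1 x; rewrite ler_norml => /andP[+ _].
    by have := h_gt0; rewrite /t mulr0 mul0r; lra.
  rewrite ltNge; apply: contra wi => xi.
  have xa : (x <= (a i)%:E)%E.
    rewrite -le_contract contract_a//; move: xi; rewrite /t -[i.+1%:R]natr1.
    by have := h_gt0; lra.
  have di : rise i.+1 x = 0 by rewrite riseS ?prim1_unif_eq0.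
  rewrite /weight di sub0r oppr_eq0 eq_le rise_ge0 andbT.
  by apply: le_trans (rise_nonincreasing x i_n) _; rewrite di.
have : (i <= n.+1)%N by rewrite -ltnS.
rewrite leq_eqVlt => /orP[/eqP ->|i_n].
  have := contract_le1 x; rewrite ler_norml => /andP[_].
  by rewrite tn; have := h_gt0; lra.
rewrite ltNge; apply: contra wi => xi.
have xb : ((b i)%:E <= x)%E.
  by rewrite -le_contract contract_b//; move: xi; have := h_gt0; lra.
have di : rise i.+1 x = 1 by rewrite riseS ?prim1_unif_eq1 ?a_lt_b.
rewrite /weight di subr_eq0 eq_le rise_le1/=.
by rewrite (le_trans _ (rise_nonincreasing x (ltn_ord i)))// di.
Qed.

End partition_of_unity.

(** The primitives of integrable functions are dense: [F] is interpolated by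
    means of weights that are themselves primitives of step functions; the
    weight attached to minus infinity is not, but there [F] vanishes. *)
Lemma smear_quadrant_dense F (e : R) : Bc F -> 0 < e ->
  exists2 g, L1 g & forall z, `|F z - smear quadrant g z| <= e.
Proof.
move=> [cF F0] e0.
have [d d0 dF] : exists2 d : R, 0 < d & forall z z', ball z d z' -> `|F z - F z'| < e.
  have := continuous_ereal2_uniform cF e0; move=> [d /= d0 dF].
  exists (d / 2); first exact: divr_gt0.
  apply: dF; last exact: divr_gt0.
  rewrite /ball/= sub0r normrN gtr0_norm ?divr_gt0//.
  by rewrite ltr_pdivrMr// ltr_pMr// ltr1n.
have [n _ /(_ n (leqnn n)) nd] := near_infty_natSinv_lt (PosNum (divr_gt0 d0 (ltr0n _ 2))).
have {}nd : 2 * n.+1%:R^-1 < d by rewrite -ltr_pdivlMl// mulrC.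
pose p (i : 'I_n.+2) := node n i.
pose m (i : 'I_n.+2) s : R := density n i s - density n i.+1 s.
have im i : mu.-integrable setT (EFin \o m i).
  by apply: eq_integrable (integrableB measurableT
    (integrable_density n i) (integrable_density n i.+1)).
pose g := fun w => \sum_ij F (p ij.1, p ij.2) * tensor (m ij.1) (m ij.2) w.
have L1m (ij : 'I_n.+2 * 'I_n.+2) : L1 (tensor (m ij.1) (m ij.2)).
  exact: (@integrable_tensor _ _ mR mR).
exists g; first by apply: L1_sum => ij; exact/L1_scale.
move=> -[x y].
have -> : smear quadrant g (x, y) =
    \sum_ij F (p ij.1, p ij.2) * (weight n ij.1 x * weight n ij.2 y).
  rewrite (smear_sum _ _ smearable_quadrant)//; last by move=> ij; exact/L1_scale.
  apply: eq_bigr => -[i j] _ /=.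
  (* the weight of node 0, at minus infinity, is not a primitive *)
  rewrite (smear_scale _ _ smearable_quadrant (L1m (i, j))) (smear_tensor _ _ (im i) (im j)).
  have p0 : node n 0 = -oo%E.
    by rewrite /node mulr0 mul0r addr0 expandN1.
  have [i0|i0] := posnP i; first by rewrite /p i0 p0 (F0 _).1 !mul0r.
  have [j0|j0] := posnP j; first by rewrite /p j0 p0 (F0 _).2 !mul0r.
  by rewrite !weight_density.
apply: (@partition_approx _ _ p (fun i => weight n i)).
- exact: weight_ge0.
- exact: sum_weight.
- move=> i j x' y' wi wj; apply/ltW/dF; split; rewrite /ball/= /ereal_ball.
    exact: lt_trans (weight_support wi) nd.
  exact: lt_trans (weight_support wj) nd.
Qed.

End density.

(** * The convolution of a distribution with an integrable function *)

Section alexiewicz.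
Context {R : realType}.
Local Notation mR := (measurableTypeR R).
Local Notation mR2 := (measurableTypeR R * measurableTypeR R)%type.
Local Notation leb2 := (@leb2 R).
Implicit Types (F G : \bar R * \bar R -> R) (g h : R * R -> R) (u : testFun R -> R).

Definition mixed F : testFun R -> R := d12 (regular_distr (restrict2 F)).

Definition supnorm F : R := sup [set `|F z| | z in setT].

Lemma BcB F G : Bc F -> Bc G -> Bc (fun z => F z - G z).
Proof.
move=> [cF F0] [cG G0]; split; first by move=> z; apply: cvgB; [exact: cF|exact: cG].
by move=> s; rewrite (F0 s).1 (F0 s).2 (G0 s).1 (G0 s).2 subrr.
Qed.

Lemma BcZ (a : R) F : Bc F -> Bc (fun z => a * F z).
Proof.
move=> [cF F0]; split; first by move=> z; apply: cvgMr; exact: cF.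
by move=> s; rewrite (F0 s).1 (F0 s).2 mulr0.
Qed.

Lemma Bc_locally_L1 F : Bc F -> locally_L1 (restrict2 F).
Proof.
move=> [cF _]; have [C _ FC] := continuous_ereal2_bounded cF.
apply: (bounded_locally_L1 (C := C)); last by move=> z; exact: FC.
apply: continuous_measurable_fun2 => z.
apply: (cvg_comp (fun z : R * R => (z.1%:E, z.2%:E)) F); last exact: cF.
apply: (@cvg_pair _ _ _ _ (nbhs z.1%:E) (nbhs z.2%:E)).
  by apply: cvg_EFin; [exact: nearW|exact: cvg_fst].
by apply: cvg_EFin; [exact: nearW|exact: cvg_snd].
Qed.

Lemma mixedB F G : Bc F -> Bc G ->
  mixed (fun z => F z - G z) = mixed F - mixed G.
Proof.
move=> BF BG; apply/funext => phi.
rewrite -[RHS]/(mixed F phi - mixed G phi) /mixed !d12E.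
have LF := regular_distr_integrable (tpd true (tpd false phi)) (Bc_locally_L1 BF).
have LG := regular_distr_integrable (tpd true (tpd false phi)) (Bc_locally_L1 BG).
apply: etrans (RintegralB measurableT LF LG).
by apply: eq_Rintegral => z _; rewrite -mulrBl.
Qed.

Lemma mixedZ (a : R) F : Bc F -> mixed (fun z => a * F z) = a *: mixed F.
Proof.
move=> BF; apply/funext => phi; rewrite -[RHS]/(a * mixed F phi) /mixed !d12E.
have LF := regular_distr_integrable (tpd true (tpd false phi)) (Bc_locally_L1 BF).
apply: etrans (RintegralZl a measurableT LF).
by apply: eq_Rintegral => z _; rewrite -mulrA.
Qed.

Lemma Ac_mixed F : Bc F -> Ac (mixed F).
Proof.
move=> BF; split; last by exists F.
by do 2 apply: dpd_distribution; exact/regular_distr_distribution/Bc_locally_L1.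
Qed.

(** From here on, distributions are handled through their primitives. *)
Lemma mixed_inj F G : Bc F -> Bc G -> mixed F = mixed G -> F = G.
Proof.
move=> BF BG FG; have := primitive_unique0 (BcB BF BG).
rewrite -[d12 _]/(mixed _) mixedB// FG subrr => /(_ erefl) H.
by apply/funext => z; apply/eqP; rewrite -subr_eq0 -[_ - _]/((fun z => F z - G z) z) H.
Qed.

Lemma primitive_mixed F : Bc F -> primitive (mixed F) = F.
Proof.
move=> BF; rewrite /primitive.
have [BG E] : [set G | Bc G /\ mixed F = mixed G]
  (get [set G | Bc G /\ mixed F = mixed G]) by apply: getPex; exists F.
by apply/esym/mixed_inj.
Qed.

Lemma anorm_mixed F : Bc F -> anorm (mixed F) = supnorm F.
Proof. by move=> BF; rewrite /anorm primitive_mixed. Qed.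

Lemma le_supnorm F z : Bc F -> `|F z| <= supnorm F.
Proof.
move=> [cF _]; have [C _ FC] := continuous_ereal2_bounded cF.
apply: ub_le_sup; last by exists z.
by exists C => _ [y _ <-]; exact: FC.
Qed.

Lemma supnorm_le F (C : R) : (forall z, `|F z| <= C) -> supnorm F <= C.
Proof.
move=> FC; apply: ge_sup; first by exists `|F (0%E, 0%E)|, (0%E, 0%E).
by move=> _ [y _ <-]; exact: FC.
Qed.

Lemma supnorm_ge0 F : Bc F -> 0 <= supnorm F.
Proof. by move=> BF; exact: le_trans (le_supnorm (0%E, 0%E) BF). Qed.

Lemma regular_distr_mixed g : L1 g -> regular_distr g = mixed (smear quadrant g).
Proof. by move=> L1g; rewrite /mixed d12_smear_quadrant. Qed.

Lemma supnorm_smear F g : Bc F -> L1 g ->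
  supnorm (smear F g) <= supnorm F * normL1 g.
Proof.
move=> BF L1g; apply: supnorm_le => z.
apply: (@smear_bound _ (supnorm F)) => //.
by apply: smearable_continuous; [exact: BF.1|move=> y; exact: le_supnorm].
Qed.

Lemma cvg_eq (v w : nat -> R) (l : R) : v =1 w -> w @ \oo --> l -> v @ \oo --> l.
Proof. by move=> /funext ->. Qed.

(** The primitive of [convL1 (fn n) g] is the average of that of [fn n], by
    associativity for the quadrant, so that the norms compare primitives. *)
Lemma is_conv_mixed F g : Bc F -> L1 g -> is_conv (mixed F) g (mixed (smear F g)).
Proof.
move=> BF L1g; have BFg := smear_Bc BF L1g; split; first exact: Ac_mixed.
move=> fn L1fn.
have BPn n := smear_quadrant_Bc (L1fn n).
have BD n := BcB (BPn n) BF.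
have E1 n : anorm (regular_distr (fn n) - mixed F) =
    supnorm (fun z => smear quadrant (fn n) z - F z).
  by rewrite regular_distr_mixed// -mixedB// anorm_mixed.
have E2 n : anorm (regular_distr (convL1 (fn n) g) - mixed (smear F g)) =
    supnorm (smear (fun z => smear quadrant (fn n) z - F z) g).
  have L1c := L1_convL1 (L1fn n) L1g.
  rewrite regular_distr_mixed// -mixedB//; last exact: smear_quadrant_Bc.
  rewrite anorm_mixed; last exact: BcB (smear_quadrant_Bc L1c) BFg.
  rewrite -(smear_smear smearable_quadrant)//.
  have sc G : Bc G -> smearable (supnorm G) G.
    by move=> BG; apply: smearable_continuous; [exact: BG.1|move=> y; exact: le_supnorm].
  by rewrite (smearB (sc _ (BPn n)) (sc _ BF) L1g).
move=> /(cvg_eq (fun n => esym (E1 n))) cv; apply: (cvg_eq E2); apply: (@squeeze_cvgr _ _ _ _ (fun=> 0)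
  (fun n => supnorm (fun z => smear quadrant (fn n) z - F z) * normL1 g)).
- apply: nearW => n; rewrite supnorm_ge0/=; last exact: smear_Bc.
  exact: supnorm_smear.
- exact: cvg_cst.
- by rewrite -(mul0r (normL1 g)); apply: cvgMl.
Qed.

Lemma L1_dense F : Bc F -> exists2 fn : nat -> R * R -> R,
  forall n, L1 (fn n) & anorm (regular_distr (fn n) - mixed F) @[n --> \oo] --> (0 : R).
Proof.
move=> BF.
have /choice[fn fnP] : forall n : nat, exists g, L1 g /\
    forall z, `|F z - smear quadrant g z| <= n.+1%:R^-1.
  move=> n; have [|g L1g gF] := smear_quadrant_dense BF (e := n.+1%:R^-1).
    by rewrite invr_gt0.
  by exists g.
have L1fn n := (fnP n).1; exists fn => //.
apply: (@squeeze_cvgr _ _ _ _ (fun=> 0) (fun n => n.+1%:R^-1)).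
- apply: nearW => n; have BP := smear_quadrant_Bc (L1fn n).
  rewrite regular_distr_mixed// -mixedB// anorm_mixed; last exact: BcB.
  rewrite supnorm_ge0/=; last exact: BcB.
  by apply: supnorm_le => z; rewrite distrC; exact: (fnP n).2.
- exact: cvg_cst.
- exact: cvg_harmonic.
Qed.

(** Density provides a sequence along which two candidates have a common
    limit. *)
Lemma is_conv_unique F g u : Bc F -> L1 g -> is_conv (mixed F) g u ->
  u = mixed (smear F g).
Proof.
move=> BF L1g [[_ [U BU ->]] cvU]; rewrite -/(mixed U) in cvU *.
have [_ cvV] := is_conv_mixed BF L1g; have BV := smear_Bc BF L1g.
have [fn L1fn fnF] := L1_dense BF.
have L1c n := L1_convL1 (L1fn n) L1g.
congr mixed; apply/funext => z; apply/eqP; rewrite -subr_eq0 -normr_le0.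
pose W n := smear quadrant (convL1 (fn n) g).
have BW n : Bc (W n) by exact: smear_quadrant_Bc.
have cU := cvU fn L1fn fnF; have cV := cvV fn L1fn fnF.
have c : (fun n => anorm (regular_distr (convL1 (fn n) g) - mixed U) +
    anorm (regular_distr (convL1 (fn n) g) - mixed (smear F g))) @ \oo --> (0 : R).
  have -> : (0 : R) = 0 + 0 by rewrite addr0.
  exact: (cvgD cU cV).
apply: (ler_cvg_to (cvg_cst _) c); apply: nearW => n.
rewrite regular_distr_mixed// -/(W n) -!mixedB// !anorm_mixed; try exact: BcB.
have -> : U z - smear F g z = (W n z - smear F g z) - (W n z - U z).
  by rewrite opprB [RHS]addrC addrA subrK.
rewrite (le_trans (ler_normB _ _))// addrC lerD//.
  exact: (le_supnorm z (BcB (BW n) BU)).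
exact: (le_supnorm z (BcB (BW n) BV)).
Qed.

Lemma convAc_mixed F g : Bc F -> L1 g -> convAc (mixed F) g = mixed (smear F g).
Proof.
move=> BF L1g; apply: is_conv_unique => //; rewrite /convAc.
by apply: getPex; exists (mixed (smear F g)); exact: is_conv_mixed.
Qed.

Lemma dilateE (r : R) g : dilate r g = fun z => r^-2 * (g \o affine2 r^-1 (0, 0)) z.
Proof. by apply/funext => z; rewrite /dilate /affine2/= !addr0. Qed.

Lemma L1_dilate (r : R) g : 0 < r -> L1 g -> L1 (dilate r g).
Proof.
move=> r0 L1g; rewrite dilateE; apply: L1_scale.
by apply: (L1_affine _ _ L1g).1; rewrite invr_gt0.
Qed.

Lemma iint_dilate (r : R) g : 0 < r -> L1 g -> iint (dilate r g) = iint g.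
Proof.
move=> r0 L1g; have ri0 : 0 < r^-1 by rewrite invr_gt0.
rewrite !iintE//; last exact: L1_dilate.
have [L1a E] := L1_affine (0, 0) ri0 L1g.
rewrite dilateE RintegralZl// E.
by rewrite exprVn invrK mulKf// expf_neq0// gt_eqF.
Qed.

Lemma smear_dilate F g (r : R) z : 0 < r -> Bc F -> L1 g ->
  smear F (dilate r g) z = \int[leb2]_w (F (eshift z (scale2 r w)) * g w).
Proof.
move=> r0 [cF _] L1g; have [C _ FC] := continuous_ereal2_bounded cF.
have ri0 : 0 < r^-1 by rewrite invr_gt0.
pose k w := F (eshift z (scale2 r w)) * g w.
have L1k : L1 k.
  apply: (@integrable_bounded_mul _ _ _ leb2 _ _ C) => //.
  exact: measurable_scaled.
have [L1a E] := L1_affine (0, 0) ri0 L1k.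
rewrite -[RHS](mulKf (x := r^+2)) ?expf_neq0 ?gt_eqF//.
have -> : r ^+ 2 * (\int[leb2]_w k w) = \int[leb2]_w k (affine2 r^-1 (0, 0) w).
  by rewrite E exprVn invrK.
rewrite -RintegralZl//; apply: eq_Rintegral => w _.
rewrite /k dilateE /= mulrCA; congr (_ * (F _ * _)).
by rewrite /eshift /scale2 /affine2/= !addr0 !mulVKf ?gt_eqF.
Qed.

(** Approximate identities: a point almost realizing the supremum is attached
    to each term of a sequence of dilations, and the averages are compared
    along these points. *)
Lemma cvg_dilate F g : Bc F -> L1 g ->
  supnorm (fun z => smear F (dilate r g) z - iint g * F z) @[r --> 0^'+] --> (0 : R).
Proof.
move=> BF L1g; have cF := BF.1.
have [C _ FC] := continuous_ereal2_bounded cF.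
apply/cvg_at_rightP => r [r0 rcv].
pose D n z := smear F (dilate (r n) g) z - iint g * F z.
have BD n : Bc (D n) by apply: BcB; [exact/smear_Bc/L1_dilate|exact: BcZ].
have /choice[v vD] : forall n, exists z, supnorm (D n) <= 2 * `|D n z|.
  move=> n; apply: contrapT => /forallNP nD.
  (* otherwise half of the supremum would be an upper bound *)
  have Dlt z : `|D n z| <= supnorm (D n) / 2.
    by have /negP := nD z; rewrite -ltNge => /ltW; rewrite ler_pdivlMr// mulrC.
  have s0 := supnorm_le Dlt; have := nD (0%E, 0%E).
  by apply; rewrite (@le_trans _ _ 0) ?mulr_ge0//; have := supnorm_ge0 (BD n); lra.
have DE n : D n (v n) =
    \int[leb2]_w ((F (eshift (v n) (scale2 (r n) w)) - F (v n)) * g w).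
  rewrite /D smear_dilate// iintE// mulrC -RintegralZl//.
  have i1 : L1 (fun w => F (eshift (v n) (scale2 (r n) w)) * g w).
    apply: (@integrable_bounded_mul _ _ _ leb2 _ _ C) => //.
    exact: measurable_scaled.
  have i2 := L1_scale (F (v n)) L1g.
  apply: etrans (esym (RintegralB measurableT i1 i2)) _.
  by apply: eq_Rintegral => w _; rewrite mulrBl.
have cD : D n (v n) @[n --> \oo] --> (0 : R).
  exact: (cvg_eq DE (cvg_concentrate v cF L1g rcv)).
have cD2 : 2 * `|D n (v n)| @[n --> \oo] --> 2 * `|0 : R|.
  by apply: cvgMr; exact: cvg_norm.
rewrite normr0 mulr0 in cD2.
apply: (@squeeze_cvgr _ _ _ _ (fun=> 0) (fun n => 2 * `|D n (v n)|)) cD2.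
  by apply: nearW => n; apply/andP; split; [exact: (supnorm_ge0 (BD n))|exact: vD].
exact: cvg_cst.
Qed.

End alexiewicz.

Theorem theorem14p3 (R : realType) (f : testFun R -> R) (g : R * R -> R)
    (hf : Ac f) (hg : L1 g) :
  (exists! u : testFun R -> R, is_conv f g u) /\
  (Ac (convAc f g) /\ anorm (convAc f g) <= anorm f * normL1 g) /\
  (forall h : R * R -> R, L1 h ->
     convAc (convAc f g) h = convAc f (convL1 g h) /\ Ac (convAc f (convL1 g h))) /\
  (forall r : R, 0 < r -> iint (dilate r g) = iint g) /\
  anorm (convAc f (dilate r g) - iint g *: f) @[r --> 0^'+] --> (0 : R).
Proof.
have [_ [F BF ->]] := hf; rewrite -/(mixed F).
have BFg := smear_Bc BF hg.
split; first by exists (mixed (smear F g)); split;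
  [exact: is_conv_mixed|move=> u /(is_conv_unique BF hg)].
split.
  rewrite (convAc_mixed BF hg); split; first exact: Ac_mixed.
  by rewrite !anorm_mixed// supnorm_smear.
split=> [h hh|].
  have L1gh := L1_convL1 hg hh.
  rewrite (convAc_mixed BF hg) (convAc_mixed BFg hh) (convAc_mixed BF L1gh).
  have [C _ FC] := continuous_ereal2_bounded BF.1.
  rewrite (smear_smear (smearable_continuous BF.1 FC) hg hh).
  by split => //; apply: Ac_mixed; exact: smear_Bc.
split; first by move=> r r0; exact: iint_dilate.
have := cvg_dilate BF hg; apply: cvg_trans; apply: near_eq_cvg.
near=> r; have r0 : 0 < r by near: r; exact: nbhs_right_gt.
have L1d := L1_dilate r0 hg.
rewrite (convAc_mixed BF L1d) -mixedZ// -mixedB ?anorm_mixed//.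
- by apply: BcB; [exact: smear_Bc|exact: BcZ].
- exact: smear_Bc.
- exact: BcZ.
Unshelve. all: end_near. Qed.
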